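(* Let $c\ge1$ and let $f:\mathbb{N}\to\mathbb{R}$ be an additive function with $f(p)=(\log p)^{-c}$ for every prime $p$. Let $F$ be the limit distribution function of $f$. Then there are absolute constants $C_1,C_2>0$ such that for all $0<\epsilon\le1/2$, \[ C_1\,\epsilon^{1/c}\le Q_F(\epsilon)\le C_2\min\left\{\frac{c}{c-1},\log\frac1\epsilon\right\}\epsilon^{1/c}, \] where for $c=1$ the quantity $c/(c-1)$ is interpreted as $+\infty$ (so the minimum equals $\log(1/\epsilon)$).
   Context: A function $f:\mathbb{N}\to\mathbb{R}$ is additive if $f(mn)=f(m)+f(n)$ whenever $\gcd(m,n)=1$ (the values $f(p^k)$, $k\ge2$, are arbitrary). The limit distribution function of $f$ is the distribution function $F:\mathbb{R}\to[0,1]$ such that $\frac{1}{\lfloor x\rfloor}\#\{n\le x: f(n)\le u\}\to F(u)$ as $x\to\infty$ for every continuity point $u$ of $F$ (it exists for such $f$ by the Erdős–Wintner theorem). For a distribution function $G$, its concentration function is $Q_G(\epsilon)=\sup_{u\in\mathbb{R}}\{G(u+\epsilon)-G(u)\}$. *)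

(* Defs.v *)
From mathcomp Require Export all_boot all_order all_algebra.
From mathcomp Require Export all_classical all_reals all_analysis.

Set Implicit Arguments.
Unset Strict Implicit.
Unset Printing Implicit Defensive.

Import Order.TTheory GRing.Theory Num.Theory.
Import numFieldNormedType.Exports.

Local Open Scope classical_set_scope.
Local Open Scope ring_scope.

(* Arithmetic functions live on the positive integers: the value at 0 is
   irrelevant and never constrained. *)
Definition additive_function (R : realType) (f : nat -> R) : Prop :=
  forall m n : nat, (0 < m)%N -> (0 < n)%N -> coprime m n ->
    f (m * n)%N = f m + f n.

Definition empirical_cdf (R : realType) (f : nat -> R) (u x : R) : R :=
  (count (fun n => f n <= u) (index_iota 1 (Num.truncn x).+1))%:R
  / (Num.truncn x)%:R.

(* A distribution function is an [F : cumulativeBounded 0 1], i.e. nondecreasing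
   and right-continuous with limits 0 at -oo and 1 at +oo. *)
Definition is_limit_distribution (R : realType) (f : nat -> R)
    (F : cumulativeBounded (0 : R) (1 : R)) : Prop :=
  forall u : R, {for u, continuous F} ->
    empirical_cdf f u x @[x --> +oo] --> F u.

Definition concentration (R : realType) (G : R -> R) (eps : R) : R :=
  sup (range (fun u : R => G (u + eps) - G u)).

(* min {c / (c - 1), log (1 / eps)}, where c / (c - 1) is read as +oo at c = 1
   (in the library it would be 1 / 0 = 0). *)
Definition min_factor (R : realType) (c eps : R) : R :=
  if c == 1 then ln (1 / eps) else Num.min (c / (c - 1)) (ln (1 / eps)).

(* Main.v *)
Require Import Defs.
From mathcomp Require cyclic.
From mathcomp Require Import ring lra zify.
Import Order.TTheory GRing.Theory Num.Theory.
Import numFieldNormedType.Exports.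
Local Open Scope classical_set_scope.
Local Open Scope ring_scope.

Set Implicit Arguments.
Unset Strict Implicit.
Unset Printing Implicit Defensive.

(* Write t = eps^(1/c) and Y = 1/t. The limit law may be computed with
   logarithmic density, for which the squarefree part of n made of primes up to
   exp(Y) decouples from the rest: the concentration of f is at most O(1/Y) times
   the largest sum N of 1/a over squarefree a, composed of primes up to exp(Y),
   with f(a) in a given window of length 2 eps. The values f(p) are well spaced,
   so Selberg's sieve bounds the sum of 1/p over the primes p > exp(v) with
   log p <= w and f(p) in a window of length d by O(d w^c + exp(-v/2)). Let
   w = 2 log Y. If the least prime p > exp(w) dividing a satisfies log p ~ V, then
   p lies in such a set given the rest of a, while the exp(w)-smooth part of a has
   its f-value in a window of length about V^(-c), which confines it to a set of
   bounded logarithmic mass unless V is close to w. Summing over dyadic V gives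
   N << sum over V of (V/Y)^(c-1) << min(c/(c-1), log(1/eps)).
   For the lower bound, squarefree n without prime factors up to exp(512 Y) have
   density of order 1/Y, and by Markov's inequality at least half of them satisfy
   f(n) <= eps/4. *)

(** The exponent c - 1 comes from a balance of masses. At scale V the sieve gives the prime p mass
    about d V^c, that is (V/Y)^c, and the primes between exp(V) and exp(Y) contribute a factor Y/V;
    the product is (V/Y)^(c-1). At c = 1 all dyadic scales weigh the same, whence the logarithm; for
    c > 1 they form a geometric series. The choice w = 2 log Y makes the sieve remainder exp(-w/2)
    equal to 1/Y, which the factor Y/V turns into 1/V, summable over dyadic V. Primes below exp(w)
    cannot be treated this way; there the total mass is only of order w, and halving w repeatedly
    gives remainders w exp(-w/4) that are summable. Logarithmic weights are used because 1/n is
    multiplicative: in n = a m the size of a need not be tracked. Since the limit law is given,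
    comparing coefficients of ln N transfers bounds between logarithmic sums and increments of F.
    Constants must not depend on c, so a numerical factor is raised to the power c only where this
    helps or where it stays next to a small base. *)

Lemma ler_sum_inj (R : numDomainType) (I J : finType) (P : pred I) (Q : pred J)
    (h : I -> J) (F : I -> R) (G : J -> R) :
  {in P &, injective h} -> (forall i, P i -> Q (h i) /\ F i <= G (h i)) ->
  (forall j, Q j -> 0 <= G j) ->
  \sum_(i | P i) F i <= \sum_(j | Q j) G j.
Proof.
move=> hinj hPQ hG.
apply: (@le_trans _ _ (\sum_(i | P i) G (h i))).
  by apply: ler_sum => i /hPQ[].
rewrite -(big_imset G (A := P) (h := h)) //=.
rewrite [leLHS]big_mkcond [leRHS]big_mkcond /=; apply: ler_sum => j _.
case: imsetP => [[i Pi ->]|_].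
  by have [-> _] := hPQ _ Pi.
by case: ifP => // /hG.
Qed.

(** * Squarefree numbers *)

Definition sqfree (n : nat) : bool :=
  (0 < n)%N && all (fun p => ~~ (p ^ 2 %| n)%N) (primes n).

Lemma sqfreeP (n : nat) :
  reflect ((0 < n)%N /\ forall p, prime p -> ~~ (p ^ 2 %| n)%N) (sqfree n).
Proof.
apply: (iffP andP) => -[n0 H]; split=> //.
  move=> p pp; apply/negP => pn; move/allP/(_ p): H.
  rewrite mem_primes pp n0 (dvdn_trans _ pn) ?pn; last by rewrite dvdn_exp.
  by move=> /(_ isT).
by apply/allP => p; rewrite mem_primes => /and3P[/H].
Qed.

Lemma sqfree_gt0 n : sqfree n -> (0 < n)%N. Proof. by case/andP. Qed.

Lemma sqfreeMl p k : prime p -> ~~ (p %| k)%N -> sqfree (p * k)%N = sqfree k.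
Proof.
move=> pp pk; apply/sqfreeP/sqfreeP => -[n0 H].
  split; first by move: n0; rewrite muln_gt0 => /andP[].
  by move=> q qp; apply: contra (H q qp) => /dvdn_mull ->.
split=> [|q qp]; first by rewrite muln_gt0 prime_gt0.
have [->|qnp] := eqVneq q p.
  by rewrite expnS expn1 dvdn_pmul2l ?prime_gt0.
rewrite Gauss_dvdr ?H // coprimeXl // prime_coprime //.
by rewrite dvdn_prime2.
Qed.

Lemma sqfreeM_dvd p k : prime p -> (p %| k)%N -> sqfree (p * k)%N = false.
Proof.
move=> pp pk; apply/negP => /sqfreeP[_ /(_ p pp)].
by rewrite expnS expn1 dvdn_pmul2l ?pk ?prime_gt0.
Qed.

Lemma sqfree_decomp n : (0 < n)%N -> exists d m, sqfree d /\ n = (d * m ^ 2)%N.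
Proof.
elim/ltn_ind: n => n IH n0.
have [sn|] := boolP (sqfree n); first by exists n, 1%N; rewrite exp1n muln1.
rewrite /sqfree n0 /= => /allPn[p].
rewrite mem_primes negbK => /and3P[pp _ _] /dvdnP[k nE].
have k0 : (0 < k)%N by move: n0; rewrite nE; case: k {nE}.
have kn : (k < n)%N.
  by rewrite nE -{1}(muln1 k) ltn_pmul2l // -(exp1n 2) ltn_exp2r // prime_gt1.
have [d [m [sd kE]]] := IH _ kn k0.
by exists d, (m * p)%N; split=> //; rewrite nE kE expnMn mulnA.
Qed.

Lemma perm_primesM p k : prime p -> (0 < k)%N -> ~~ (p %| k)%N ->
  perm_eq (primes (p * k)) (p :: primes k).
Proof.
move=> pp k0 pk; apply: uniq_perm; rewrite ?primes_uniq //= ?primes_uniq ?andbT.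
  by rewrite mem_primes (negbTE pk) !andbF.
move=> q; rewrite in_cons !mem_primes muln_gt0 prime_gt0 // k0 /=.
have [qp|/negbTE qnp] := boolP (prime q); last first.
  by rewrite /= orbF; apply/esym/negbTE; apply: contraFneq qnp => ->.
by rewrite Euclid_dvdM //= dvdn_prime2.
Qed.

(** * Harmonic sums and squarefree numbers *)

Section Harmonic.
Context {R : realType}.
Implicit Types (x y : R) (n N : nat).

Lemma sum_ord_recr (F : nat -> R) n :
  \sum_(i < n.+1) F i = \sum_(i < n) F i + F n.
Proof. by rewrite big_ord_recr. Qed.

(** The term n = 0 is 0^-1 = 0, so this is the N-th harmonic number. *)
Definition harm N : R := \sum_(n < N.+1) n%:R^-1.

Lemma ln_le_subr1 x : 0 < x -> ln x <= x - 1.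
Proof. by move=> x0; rewrite -{1}(subrK 1 x) addrC le_ln1Dx //; lra. Qed.

Lemma ln_ge_1subV x : 0 < x -> 1 - x^-1 <= ln x.
Proof.
move=> x0; have := @ln_le_subr1 x^-1; rewrite invr_gt0 => /(_ x0).
by rewrite lnV ?posrE //; lra.
Qed.

Lemma ln_succ_sub_le n : (0 < n)%N -> ln (n.+1%:R : R) - ln n%:R <= n%:R^-1.
Proof.
move=> n0; have n0' : 0 < n%:R :> R by rewrite ltr0n.
rewrite -ln_div ?posrE ?ltr0n //; apply: le_trans (ln_le_subr1 _) _.
  by rewrite divr_gt0 ?ltr0n.
by rewrite -natr1 mulrDl divff ?gt_eqF // mul1r addrAC subrr add0r.
Qed.

Lemma ln_succ_sub_ge n : (0 < n)%N -> n.+1%:R^-1 <= ln (n.+1%:R : R) - ln n%:R.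
Proof.
move=> n0; have n0' : 0 < n%:R :> R by rewrite ltr0n.
rewrite -ln_div ?posrE ?ltr0n //; apply: le_trans _ (ln_ge_1subV _).
  rewrite invf_div -natr1 le_eqVlt; apply/orP; left; apply/eqP; field.
  by rewrite gt_eqF // addr_gt0.
by rewrite divr_gt0 ?ltr0n.
Qed.

Lemma ln_le_harm N : ln (N.+1%:R : R) <= harm N.
Proof.
rewrite /harm; elim: N => [|N IH].
  by rewrite ln1 big_ord_recr big_ord0 /= invr0 addr0.
by rewrite (sum_ord_recr (fun n => n%:R^-1)); have := ln_succ_sub_le (ltn0Sn N); move: IH; move: (N.+1%:R^-1) => z; lra.
Qed.

Lemma harm_le_ln N : (0 < N)%N -> harm N <= 1 + ln (N%:R : R).
Proof.
rewrite /harm; elim: N => [//|[_ _|N IH _]].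
  by rewrite !big_ord_recr big_ord0 /= ln1 invr0 invr1 !add0r addr0.
rewrite (sum_ord_recr (fun n => n%:R^-1)); have := ln_succ_sub_ge (ltn0Sn N).
by have := IH isT; move: (N.+2%:R^-1) => z; lra.
Qed.

Lemma sum_invsq_le N : \sum_(n < N.+1) ((n ^ 2)%N%:R^-1 : R) <= 2.
Proof.
(* The sharper bound 2 - 1/N carries the induction, through 1/(n+1)^2 <= 1/n - 1/(n+1). *)
suff: (0 < N)%N -> \sum_(n < N.+1) ((n ^ 2)%N%:R^-1 : R) <= 2 - N%:R^-1.
  case: N => [|N] H; first by rewrite big_ord_recr big_ord0 /= invr0; lra.
  by apply: le_trans (H _) _ => //; rewrite gerBl invr_ge0.
elim: N => [//|[_ _|N IH _]].
  by rewrite !big_ord_recr big_ord0 /= invr0 invr1 !add0r; lra.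
rewrite (sum_ord_recr (fun n => (n ^ 2)%N%:R^-1)); have {}IH := IH isT.
suff: ((N.+2 ^ 2)%N%:R^-1 : R) <= N.+1%:R^-1 - N.+2%:R^-1.
  by move: IH; move: (N.+2%:R^-1) ((N.+2 ^ 2)%N%:R^-1) (N.+1%:R^-1) => x y z; lra.
rewrite -[X in _ <= X - _]mul1r -[X in _ <= _ - X]mul1r.
rewrite -mulNr addf_div ?gt_eqF ?ltr0n // ?ltr0n //.
rewrite mul1r mulN1r -natrB // subSnn mul1r lef_pV2 ?posrE -?natrM ?ltr0n ?muln_gt0 ?expn_gt0 //.
by rewrite ler_nat mulnC; nia.
Qed.

(* Every n factors as d * m^2 with d squarefree, and sum 1/m^2 <= 2. *)
Lemma harm_le_sqfree N :
  harm N <= 2 * \sum_(d < N.+1 | sqfree d) (d%:R^-1 : R).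
Proof.
apply: (@le_trans _ _ (\sum_(m < N.+1) \sum_(d < N.+1 | sqfree d)
   ((m ^ 2)%N%:R^-1 * d%:R^-1 : R))); last first.
  under eq_bigr do rewrite -mulr_sumr.
  rewrite -mulr_suml ler_wpM2r ?sum_invsq_le //.
  by apply: sumr_ge0 => i _; rewrite invr_ge0.
rewrite pair_big_dep /= /harm.
pose dm (n : nat) := if (0 < n)%N =P true is ReflectT n0
  then let: exist d Hd := cid (sqfree_decomp n0) in (sval (cid Hd), d) else (0, 0)%N.
have dmE n : (0 < n)%N -> sqfree (dm n).2 /\ n = ((dm n).2 * (dm n).1 ^ 2)%N.
  move=> n0; rewrite /dm; case: eqP => // n0'.
  by case: cid => d Hd /=; case: cid.
rewrite big_ord_recl /= invr0 add0r.
under eq_bigr do rewrite /bump leq0n add1n.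
apply: (@ler_sum_inj R 'I_N ('I_N.+1 * 'I_N.+1)%type xpredT _
  (fun i => (inord (dm i.+1).1, inord (dm i.+1).2))).
- have bd i : (i < N)%N -> ((dm i.+1).1 < N.+1)%N /\ ((dm i.+1).2 < N.+1)%N.
    move=> iN; have [s E] := dmE i.+1 isT; move: E.
    move: (dm _).1 (dm _).2 (sqfree_gt0 s) => m d d0 E; split; nia.
  move=> i j _ _ [] /(congr1 val) /= + /(congr1 val) /=.
  have [b1 b2] := bd _ (ltn_ord i); have [b3 b4] := bd _ (ltn_ord j).
  rewrite !inordK // => E1 E2; apply/val_inj/succn_inj.
  have [_ ->] := dmE i.+1 isT; have [_ ->] := dmE j.+1 isT.
  by rewrite E1 E2.
- move=> i _ /=; have [s E] := dmE i.+1 isT.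
  have [b1 b2] : ((dm i.+1).1 < N.+1)%N /\ ((dm i.+1).2 < N.+1)%N.
    have := ltn_ord i; move: E.
    move: (dm _).1 (dm _).2 (sqfree_gt0 s) => m d d0 E; split; nia.
  by rewrite !inordK //; split=> //; rewrite [X in X%:R^-1 <= _]E natrM invfM mulrC.
- by move=> j _; rewrite mulr_ge0 // invr_ge0.
Qed.

End Harmonic.

(** * The Moebius function *)

Section Moebius.
Context {R : realType}.
Implicit Types (k m n p : nat).

Definition moebius n : R := if sqfree n then (-1) ^+ size (primes n) else 0.

Lemma moebius0 : moebius 0 = 0. Proof. by []. Qed.

Lemma moebius1 : moebius 1 = 1. Proof. by []. Qed.

Lemma moebius_sqr n : moebius n * moebius n = (sqfree n)%:R.
Proof.
rewrite /moebius; case: ifP => _; last by rewrite mul0r.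
by rewrite -expr2 sqrr_sign.
Qed.

Lemma norm_moebius n : `|moebius n| = (sqfree n)%:R.
Proof.
rewrite /moebius; case: ifP => _; last by rewrite normr0.
by rewrite normrX normrN1 expr1n.
Qed.

Lemma moebius_primeM p k : prime p -> ~~ (p %| k)%N ->
  moebius (p * k)%N = - moebius k.
Proof.
move=> pp pk; have k0 : (0 < k)%N by case: k pk => //; rewrite dvdn0.
rewrite /moebius sqfreeMl //; case: ifP => _; last by rewrite oppr0.
by rewrite (perm_size (perm_primesM pp k0 pk)) /= exprS mulN1r.
Qed.

Lemma moebius_primeM_dvd p k : prime p -> (p %| k)%N -> moebius (p * k)%N = 0.
Proof. by move=> pp pk; rewrite /moebius sqfreeM_dvd. Qed.

(** For n > 1 let p be its least prime factor. Divisors k with p^2 | k contribute 0, and the others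
    cancel in pairs k, p k with p not dividing k. *)
Lemma sum_moebius N n : (0 < n < N)%N ->
  \sum_(k < N | (k %| n)%N) moebius k = (n == 1)%:R.
Proof.
case/andP=> n0 nN; have [->|n1] := eqVneq n 1.
  have N1 : (1 < N)%N by lia.
  rewrite (bigD1 (Ordinal N1)) //= big1 ?addr0 ?moebius1 // => i /andP[].
  by rewrite dvdn1 => /eqP i1 /eqP[]; exact/val_inj.
have pp : prime (pdiv n) by rewrite pdiv_prime //; lia.
set p := pdiv n in pp; have pn : (p %| n)%N by exact: pdiv_dvd.
have p0 := prime_gt0 pp.
rewrite (bigID (fun k : 'I_N => (p %| k)%N)) /=.
rewrite (bigID (fun k : 'I_N => (p %| k %/ p)%N)) /= big1 ?add0r; last first.
  move=> k /andP[/andP[_ /dvdnP[j ->]]]; rewrite mulnK // => pj.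
  by rewrite mulnC moebius_primeM_dvd.
have lt k : (k %| n)%N -> (k < N)%N by move=> /(dvdn_leq n0); lia.
have dv (k : nat) : (k %| n)%N -> ~~ (p %| k)%N -> (p * k %| n)%N.
  move=> kn pk; rewrite Gauss_dvd ?pn // prime_coprime //.
pose N1 := N.-1; have NE : N = N1.+1 by rewrite /N1 prednK //; lia.
clearbody N1; subst N.
rewrite (reindex_onto (fun k : 'I_N1.+1 => inord (p * k)%N)
                      (fun k : 'I_N1.+1 => inord (k %/ p)%N)); last first.
  move=> i /andP[/andP[_ /dvdnP[j ij]] _]; apply/val_inj => /=.
  have jN : (j < N1.+1)%N by have := ltn_ord i; rewrite ij; nia.
  by rewrite ij mulnK // (inordK jN) mulnC -ij inordK.
rewrite -[X in _ + X](opprK) -sumrN; apply/eqP; rewrite subr_eq0; apply/eqP.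
have H (k : 'I_N1.+1) :
    [&& [&& (inord (p * k) : 'I_N1.+1) %| n, p %| (inord (p * k) : 'I_N1.+1)
     & ~~ (p %| (inord (p * k) : 'I_N1.+1) %/ p)],
     inord ((inord (p * k) : 'I_N1.+1) %/ p) == k &  true]%N
     = ((k %| n) && ~~ (p %| k))%N.
  have [lpk|lpk] := ltnP (p * k) N1.+1.
    rewrite inordK // mulKn // inord_val eqxx andbT dvdn_mulr //= andbT.
    apply/andP/andP => -[h1 h2]; split=> //; last exact: dv.
    by apply: dvdn_trans h1; rewrite dvdn_mull.
  rewrite [RHS]negbTE; last first.
    by apply/negP => /andP[h1 h2]; have := lt _ (dv _ h1 h2); lia.
  (* Out of range, [inord] returns 0, which the condition that p does not divide 0 %/ p rules
     out. *)
  rewrite /inord /insubd insubF /=; last by apply/negbTE; lia.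
  by rewrite div0n dvdn0 !andbF.
apply: eq_big => k.
  by rewrite -H andbT !andbA.
move=> Hk; have /andP[kn pk] : ((k %| n) && ~~ (p %| k))%N by move: Hk; rewrite -H andbT !andbA.
by rewrite inordK ?moebius_primeM // lt // dv.
Qed.

(** Dual Moebius inversion: if m = g n, the map e -> m / e sends the e with g | e | m onto the
    divisors of n. If g does not divide m, the sum is empty. *)
Lemma sum_moebius_div r g m : (0 < g)%N -> (0 < m <= r)%N ->
  \sum_(e < r.+1 | (g %| e)%N && (e %| m)%N) moebius (m %/ e)%N = (m == g)%:R.
Proof.
move=> g0 /andP[m0 mr].
have [/dvdnP[n mE]|gm] := boolP (g %| m)%N; last first.
  rewrite big_pred0 => [|e]; first by case: eqP gm => [->|//]; rewrite dvdnn.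
  by apply/negP => /andP[h1 h2]; move/negP: gm; apply; apply: dvdn_trans h2.
have n0 : (0 < n)%N by move: m0; rewrite mE; case: n {mE}.
have -> : (m == g) = (n == 1)%N.
  by rewrite mE -{2}(mul1n g) eqn_pmul2r.
rewrite -(@sum_moebius r.+1 n) ?n0 /=; last by move: mr; rewrite mE; nia.
rewrite (reindex_onto (fun k : 'I_r.+1 => inord (m %/ k)%N)
                      (fun k : 'I_r.+1 => inord (m %/ k)%N)); last first.
  move=> i /andP[_ im]; apply/val_inj => /=.
  have i0 : (0 < i)%N by apply: dvdn_gt0 im.
  rewrite (@inordK r (m %/ i)); last by rewrite ltnS (leq_trans _ mr) // leq_div.
  by rewrite divnA // mulKn // inordK.
have bd k : (m %/ k < r.+1)%N by rewrite ltnS (leq_trans _ mr) // leq_div.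
have H (k : 'I_r.+1) : ((g %| (inord (m %/ k) : 'I_r.+1)) &&
   ((inord (m %/ k) : 'I_r.+1) %| m) &&
   (inord (m %/ (inord (m %/ k) : 'I_r.+1)) == k))%N = (k %| n)%N.
  rewrite !inordK //; apply/idP/idP.
    move=> /andP[/andP[gk km] /eqP kE].
    have kd : (k %| m)%N.
      rewrite -kE inordK //; apply/dvdnP; exists (m %/ k)%N.
      by rewrite mulnC divnK.
    have k0 := dvdn_gt0 m0 kd.
    move/dvdnP: gk => [j jE]; apply/dvdnP; exists j.
    apply/eqP; rewrite -(eqn_pmul2r g0) -mE mulnAC -jE divnK //.
  move=> kn; have kd : (k %| m)%N by rewrite mE dvdn_mulr.
  have k0 := dvdn_gt0 m0 kd.
  rewrite dvdn_div // andbT; apply/andP; split.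
    by rewrite mE -divn_mulAC // dvdn_mull.
  by apply/eqP/val_inj => /=; rewrite divnA // mulKn // inordK.
apply: eq_big => k; first exact: H.
rewrite H => kn; have kd : (k %| m)%N by rewrite mE dvdn_mulr.
have k0 := dvdn_gt0 m0 kd.
by rewrite inordK // divnA // mulKn.
Qed.

End Moebius.

(** * Selberg's sieve with logarithmic weights *)

Section Sieve.
Context {R : realType}.
Implicit Types (a b e g k m n r L : nat).

Lemma gcd_sum_totient r m n : (0 < m <= r)%N ->
  \sum_(g < r.+1 | (g %| m)%N && (g %| n)%N) totient g = gcdn m n.
Proof.
move=> /andP[m0 mr]; rewrite -[RHS]cyclic.sum_totient_dvd.
have le : (gcdn m n <= r)%N by rewrite (leq_trans _ mr) // dvdn_leq // dvdn_gcdl.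
rewrite (big_ord_widen_cond r.+1 (fun d => d %| gcdn m n)%N (fun d => totient d)) //.
apply: eq_bigl => g; rewrite -dvdn_gcd; case: (boolP (g %| gcdn m n)%N) => //= h.
by rewrite ltnS dvdn_leq // gcdn_gt0 m0.
Qed.

(** Selberg's G(r), the sum of mu(m)^2 / phi(m): the density of primes is reduced by the factor
    1/G(r). *)
Definition sieve_mass r : R := \sum_(m < r.+1 | sqfree m) (totient m)%:R^-1.

Lemma harm_le_sieve_mass r : harm r <= 2 * sieve_mass r :> R.
Proof.
apply: le_trans (harm_le_sqfree r) _; rewrite ler_wpM2l //.
apply: ler_sum => d sd; have d0 := sqfree_gt0 sd.
rewrite lef_pV2 ?posrE ?ltr0n ?totient_gt0 // ler_nat.
rewrite -[leqRHS]card_ord totient_count_coprime -sum1_card.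
by rewrite big_mkord [leqRHS]big_mkcond; apply: leq_sum => i _; case: coprime.
Qed.

Lemma sieve_mass_gt0 r : (0 < r)%N -> 0 < sieve_mass r.
Proof.
move=> r0; have := harm_le_sieve_mass r; have := @ln_le_harm R r.
have : 0 < ln (r.+1%:R : R) by rewrite ln_gt0 // ltr1n.
by move: (ln _) => l; lra.
Qed.

(* Selberg's optimal weights, divided by e: the vector [sieve_v] diagonalises
   the quadratic form sum v_e v_e' gcd(e, e'). *)
Definition sieve_v r e : R := (sieve_mass r)^-1 *
  \sum_(m < r.+1 | (e %| m)%N)
    moebius m / (totient m)%:R * moebius (m %/ e)%N.

Lemma sieve_v0 r : sieve_v r 0 = 0.
Proof.
rewrite /sieve_v big1 ?mulr0 // => m; rewrite dvd0n => /eqP ->.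
by rewrite moebius0 !mul0r.
Qed.

Lemma sieve_v1 r : (0 < r)%N -> sieve_v r 1 = 1.
Proof.
move=> r0; rewrite /sieve_v -[RHS](@mulVf _ (sieve_mass r)) ?gt_eqF ?sieve_mass_gt0 //.
congr (_ * _); rewrite /sieve_mass [RHS]big_mkcond; apply: eq_big => [m|m _].
  by rewrite dvd1n.
rewrite divn1 mulrAC moebius_sqr; case: ifP => _; last by rewrite mul0r.
by rewrite mul1r.
Qed.

(** A termwise estimate. Its loss of a factor e against the classical bound for the weights e v_e
    only enlarges the sieve remainder, which ends up of order r^4 / a. *)
Lemma norm_sieve_v r e : (0 < r)%N -> `|sieve_v r e| <= 1.
Proof.
move=> r0; have G0 := sieve_mass_gt0 r0.
rewrite /sieve_v normrM normfV (gtr0_norm G0) ler_pdivrMl // mulr1.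
apply: le_trans (ler_norm_sum _ _ _) _.
rewrite /sieve_mass [leLHS]big_mkcond [leRHS]big_mkcond; apply: ler_sum => m _.
rewrite !normrM !norm_moebius normfV normr_nat.
case: ifP => _; case: sqfree => //=; rewrite ?mul0r // ?invr_ge0 //.
by rewrite mul1r ler_piMr ?invr_ge0 // lern1 leq_b1.
Qed.

(** Exchanging the sums, [sum_moebius_div] leaves only the term m = g: in these new coordinates the
    quadratic form is diagonal. *)
Lemma sum_sieve_v r g : (0 < g)%N ->
  \sum_(e < r.+1 | (g %| e)%N) sieve_v r e =
  if (g <= r)%N then (sieve_mass r)^-1 * (moebius g / (totient g)%:R) else 0.
Proof.
move=> g0; rewrite /sieve_v -mulr_sumr.
rewrite (exchange_big_dep xpredT) //=.
transitivity ((sieve_mass r)^-1 * \sum_(m < r.+1)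
    (moebius m / (totient m)%:R * (m == g :> nat)%:R)).
  congr (_ * _); apply: eq_bigr => m _; rewrite -mulr_sumr.
  have [->|m0] := posnP m; first by rewrite moebius0 !mul0r.
  by rewrite sum_moebius_div // m0 -ltnS ltn_ord.
case: leqP => gr.
  rewrite (bigD1 (Ordinal (gr : (g < r.+1)%N))) //= eqxx mulr1 big1 ?addr0 // => i ig.
  by rewrite -val_eqE /= in ig; rewrite (negbTE ig) mulr0.
rewrite big1 ?mulr0 // => i _; case: eqP => [E|_]; last by rewrite mulr0.
by have := ltn_ord i; rewrite E; lia.
Qed.

(** Writing gcd(e, e') as the sum of phi(g) over common divisors g turns the form into a sum of
    phi(g) times squares, each given by [sum_sieve_v]; what remains is G^-2 times the sum of mu^2 /
    phi, which is G. *)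
Lemma sieve_quadratic r : (0 < r)%N ->
  \sum_(e < r.+1) \sum_(e' < r.+1)
    sieve_v r e * sieve_v r e' * (gcdn e e')%:R = (sieve_mass r)^-1.
Proof.
move=> r0; have G0 := sieve_mass_gt0 r0.
transitivity (\sum_(g < r.+1) (totient g)%:R *
    (\sum_(e < r.+1 | (g %| e)%N) sieve_v r e) ^+ 2).
  under [RHS]eq_bigr => g _ do
    (rewrite expr2 big_distrlr mulr_sumr big_mkcond /=;
     under eq_bigr => i _ do rewrite mulr_sumr big_mkcond /=).
  rewrite [RHS]exchange_big /=; apply: eq_bigr => e _.
  have [E|e0] := posnP e.
    rewrite big1 => [|i _]; last by rewrite E sieve_v0 !mul0r.
    rewrite big1 // => i _; case: ifP => // _.
    by rewrite big1 // => j _; case: ifP => // _; rewrite E sieve_v0 mul0r mulr0.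
  under [RHS]eq_bigr => g _.
    rewrite (_ : (if _ then _ else _) = \sum_(i < r.+1)
       (if (g %| e)%N && (g %| i)%N then
         (totient g)%:R * (sieve_v r e * sieve_v r i) else 0)); last first.
      case: ifP => // _; last by rewrite big1.
    over.
  rewrite [RHS]exchange_big /=; apply: eq_bigr => e' _.
  rewrite -(@gcd_sum_totient r) ?e0 /=; last by rewrite -ltnS.
  rewrite natr_sum mulr_sumr [RHS]big_mkcond [LHS]big_mkcond /=.
  by apply: eq_bigr => g _; case: ifP => // _; rewrite mulrC.
transitivity (\sum_(g < r.+1) (sieve_mass r)^-1 ^+ 2 *
   (if sqfree g then (totient g)%:R^-1 else 0)).
  apply: eq_bigr => g _; have [->|g0] := posnP g.
    by rewrite (_ : totient 0 = 0%N) // mul0r mulr0.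
  rewrite sum_sieve_v // -ltnS ltn_ord expr2.
  have t0 : (totient g)%:R != 0 :> R by rewrite pnatr_eq0 -lt0n totient_gt0.
  rewrite [LHS](_ : _ = (sieve_mass r)^-1 ^+ 2 *
    (moebius g * moebius g * (totient g)%:R^-1 * ((totient g)%:R / (totient g)%:R))).
    by rewrite mulfV // mulr1 moebius_sqr; case: sqfree; rewrite ?mul1r ?mul0r.
  by ring.
rewrite -mulr_sumr -big_mkcond /= -/(sieve_mass r) expr2 -mulrA mulVf ?mulr1 //.
by rewrite gt_eqF.
Qed.

Lemma sum_multiples L a b : (0 < L)%N -> (0 < a)%N -> (a <= b.+1)%N ->
  \sum_(a <= n < b.+1 | (L %| n)%N) (n%:R^-1 : R) =
  L%:R^-1 * \sum_((a.-1 %/ L).+1 <= k < (b %/ L).+1) k%:R^-1.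
Proof.
move=> L0 a0 ab.
have [j ->] : exists j, b = (a.-1 + j)%N by exists (b - a.-1)%N; lia.
elim: j => [|j IH].
  by rewrite addn0 prednK // !big_geq // mulr0.
rewrite addnS big_mkcond big_nat_recr /=; last by lia.
rewrite -big_mkcond IH /= divnS //.
case: ifP => [/dvdnP[k kE]|_]; last by rewrite add0n addr0.
have -> : ((a.-1 + j) %/ L)%N = k.-1.
  by have := divnS (a.-1 + j) L0; rewrite kE mulnK // dvdn_mull //; lia.
have k0 : (0 < k)%N by move: kE; case: k.
rewrite add1n prednK // [in RHS]big_nat_recr /=; last first.
  have := @leq_div2r L a.-1 (a.-1 + j) (leq_addr _ _).
  by have := divnS (a.-1 + j) L0; rewrite kE mulnK // dvdn_mull //; lia.
by rewrite mulrDr kE natrM invfM [_^-1 * L%:R^-1]mulrC.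
Qed.

Lemma sum_inv_interval_ge k1 k2 : (0 < k1)%N ->
  ln (k2%:R / k1%:R : R) <= \sum_(k1 <= k < k2) k%:R^-1.
Proof.
move=> k10; have [h|h] := leqP k2 k1.
  rewrite big_geq // ln_le0 // ler_pdivrMr ?ltr0n // mul1r ler_nat //.
have k20 : (0 < k2)%N by lia.
rewrite ln_div ?posrE ?ltr0n //.
rewrite -(telescope_sumr (fun k => ln (k%:R : R)) (ltnW h)).
rewrite !big_nat; apply: ler_sum => i /andP[hi _].
by apply: ln_succ_sub_le; lia.
Qed.

Lemma sum_inv_interval_le k1 k2 : (0 < k1)%N -> (k1 <= k2)%N ->
  \sum_(k1 <= k < k2.+1) k%:R^-1 <= k1%:R^-1 + ln (k2%:R / k1%:R : R).
Proof.
move=> k10 k12; rewrite big_ltn ?ltnS // lerD2l.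
rewrite ln_div ?posrE ?ltr0n //; last by lia.
rewrite -(telescope_sumr (fun k => ln (k%:R : R)) k12) big_add1 /=.
rewrite !big_nat; apply: ler_sum => i /andP[hi _].
by apply: ln_succ_sub_ge; lia.
Qed.

(** The multiples of L give L^-1 times a harmonic sum starting near a / L. Comparing that sum with a
    logarithm costs at most L / a, so the error is 1 / a uniformly in L. *)
Lemma sum_multiples_approx L a b : (0 < L)%N -> (0 < a)%N -> (a <= b)%N ->
  `|\sum_(a <= n < b.+1 | (L %| n)%N) (n%:R^-1 : R)
    - ln (b%:R / a%:R) / L%:R| <= a%:R^-1.
Proof.
move=> L0 a0 ab; rewrite sum_multiples //; last by lia.
have LR : 0 < L%:R :> R by rewrite ltr0n.
have aR : 0 < a%:R :> R by rewrite ltr0n.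
have bR : 0 < b%:R :> R by rewrite ltr0n; lia.
rewrite [ln _ / _]mulrC -mulrBr normrM normfV (gtr0_norm LR).
rewrite ler_pdivrMl // ler_norml; apply/andP; split; last first.
  rewrite lerBlDr; set k1 := (a.-1 %/ L).+1; set k2 := (b %/ L)%N.
  have ak : a%:R / L%:R <= k1%:R :> R.
    rewrite ler_pdivrMr // -natrM ler_nat /k1.
    by have := ltn_ceil a.-1 L0; lia.
  have kb : k2%:R <= b%:R / L%:R :> R.
    by rewrite ler_pdivlMr // -natrM ler_nat /k2 leq_trunc_div.
  have ln0 : 0 <= ln (b%:R / a%:R : R).
    by rewrite ln_ge0 // ler_pdivlMr // mul1r ler_nat.
  have [h|h] := leqP k1 k2; last first.
    by rewrite big_geq // addr_ge0 // divr_ge0 // ltW.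
  apply: le_trans (sum_inv_interval_le _ h) _ => //.
  have k1R : 0 < k1%:R :> R by rewrite ltr0n.
  have k2R : 0 < k2%:R :> R by rewrite ltr0n; exact: leq_trans h.
  apply: lerD.
    by rewrite -[leRHS]invf_div lef_pV2 ?posrE // divr_gt0.
  rewrite ler_ln ?posrE ?divr_gt0 //.
  rewrite ler_pdivrMr // (le_trans kb) // -mulrA ler_wpM2l ?ler0n //.
  by rewrite ler_pdivlMl.
rewrite lerBrDr; apply: le_trans (sum_inv_interval_ge _ _) => //.
set k1 := (a.-1 %/ L).+1; set k2 := (b %/ L).+1.
have ak : k1%:R <= a%:R / L%:R * (1 + L%:R / a%:R) :> R.
  rewrite mulrDr mulr1 mulf_div [L%:R * _]mulrC divff ?mulf_neq0 ?gt_eqF //.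
  rewrite /k1 -natr1 lerD2r ler_pdivlMr // -natrM ler_nat.
  by have := leq_trunc_div a.-1 L; lia.
have kb : b%:R / L%:R <= k2%:R :> R.
  rewrite ler_pdivrMr // -natrM ler_nat /k2.
  by have := ltn_ceil b L0; lia.
have s0 : 0 < 1 + L%:R / a%:R :> R by rewrite addr_gt0 // divr_gt0.
apply: (@le_trans _ _ (ln (b%:R / a%:R) - ln (1 + L%:R / a%:R) : R)).
  by rewrite addrC lerD2l lerN2 le_ln1Dx // (lt_trans (ltrN10 R)) // divr_gt0.
have ba0 : 0 < b%:R / a%:R :> R by rewrite divr_gt0.
have q0 : 0 < b%:R / a%:R / (1 + L%:R / a%:R) :> R by rewrite divr_gt0.
rewrite -ln_div ?posrE // ler_ln ?posrE //; last by rewrite divr_gt0 ?ltr0n.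
rewrite ler_pdivlMr ?ltr0n //; apply: le_trans kb.
apply: (@le_trans _ _ (b%:R / a%:R / (1 + L%:R / a%:R) * (a%:R / L%:R * (1 + L%:R / a%:R)))).
  by rewrite ler_wpM2l // !divr_ge0 // ?ltW // divr_gt0.
rewrite le_eqVlt; apply/orP; left; apply/eqP; field.
by rewrite !gt_eqF ?addr_gt0 //.
Qed.

Lemma sieve_majorant r n : (0 < r)%N -> (r < n)%N -> prime n ->
  \sum_(e < r.+1 | (e %| n)%N) e%:R * sieve_v r e = 1.
Proof.
move=> r0 rn pn; have r1 : (1 < r.+1)%N by [].
rewrite (bigD1 (Ordinal r1)) //= mul1r sieve_v1 // big1 ?addr0 //.
move=> i /andP[/(primeP pn).2 /orP[] /eqP E i1].
  by case/eqP: i1; exact/val_inj.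
by have := ltn_ord i; rewrite E; lia.
Qed.

(** The indicator of the primes beyond r is at most the square of the sum of e v_e over e | n. After
    expansion, the multiples of lcm(e, e') have mass ln(b/a) / lcm(e, e') up to 1/a, and e e' /
    lcm(e, e') = gcd(e, e') produces the form of [sieve_quadratic]. *)
Lemma sieve_bound r a b : (0 < r)%N -> (r < a)%N -> (a <= b)%N ->
  \sum_(a <= p < b.+1 | prime p) (p%:R^-1 : R) <=
    ln (b%:R / a%:R) / sieve_mass r + (r.+1 ^ 4)%N%:R / a%:R.
Proof.
move=> r0 ra ab; have a0 : (0 < a)%N by lia.
have aR : 0 < a%:R :> R by rewrite ltr0n.
pose w e : R := e%:R * sieve_v r e.
apply: (@le_trans _ _ (\sum_(a <= n < b.+1)
   \sum_(e < r.+1) \sum_(e' < r.+1)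
     (if (lcmn e e' %| n)%N then w e * w e' * n%:R^-1 else 0))).
  rewrite big_mkcond /= !big_nat; apply: ler_sum => n /andP[an _].
  have -> : \sum_(e < r.+1) \sum_(e' < r.+1)
     (if (lcmn e e' %| n)%N then w e * w e' * n%:R^-1 else 0) =
     n%:R^-1 * (\sum_(e < r.+1 | (e %| n)%N) w e) ^+ 2.
    rewrite expr2 big_distrlr mulr_sumr [RHS]big_mkcond /=.
    apply: eq_bigr => e _; case: ifP => en; last first.
      by rewrite big1 // => e' _; rewrite dvdn_lcm en.
    rewrite mulr_sumr [RHS]big_mkcond /=; apply: eq_bigr => e' _.
    by rewrite dvdn_lcm en /=; case: ifP => // _; rewrite mulrC.
  case: ifP => pn; last by rewrite mulr_ge0 ?sqr_ge0 ?invr_ge0.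
  by rewrite sieve_majorant // ?expr1n ?mulr1 //; lia.
rewrite exchange_big /=.
under eq_bigr do rewrite exchange_big /=.
have lnE (e e' : 'I_r.+1) : w e * w e' * (ln (b%:R / a%:R) / (lcmn e e')%:R) =
   ln (b%:R / a%:R) * (sieve_v r e * sieve_v r e' * (gcdn e e')%:R).
  rewrite /w; have [->|e0] := posnP e; first by rewrite sieve_v0 !(mul0r, mulr0).
  have [->|e'0] := posnP e'; first by rewrite sieve_v0 !(mul0r, mulr0).
  have l0 : (lcmn e e')%:R != 0 :> R by rewrite pnatr_eq0 -lt0n lcmn_gt0 e0.
  have := muln_lcm_gcd e e' => /(congr1 (fun k => k%:R : R)).
  rewrite !natrM => E.
  rewrite (_ : e%:R * sieve_v r e * _ = e%:R * e'%:R * (sieve_v r e * sieve_v r e')).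
    by rewrite -E; field.
  by ring.
apply: (@le_trans _ _ (\sum_(e < r.+1) \sum_(e' < r.+1)
   (ln (b%:R / a%:R) * (sieve_v r e * sieve_v r e' * (gcdn e e')%:R)
     + (r ^ 2)%N%:R / a%:R))).
  apply: ler_sum => e _; apply: ler_sum => e' _.
  have [E|e0] := posnP e.
    rewrite E sieve_v0 !(mul0r, mulr0) add0r big1 ?divr_ge0 ?ler0n //.
    by move=> i _; rewrite /w sieve_v0 mulr0 !mul0r if_same.
  have [E|e'0] := posnP e'.
    rewrite E sieve_v0 !(mul0r, mulr0) add0r big1 ?divr_ge0 ?ler0n //.
    by move=> i _; rewrite /w sieve_v0 !mulr0 !mul0r if_same.
  rewrite -lnE -big_mkcond -mulr_sumr.
  have := @sum_multiples_approx (lcmn e e') a b _ a0 ab; rewrite lcmn_gt0 e0 => /(_ e'0).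
  set S := \sum_(_ <= _ < _ | _) _; set T := ln _ / _ => ST.
  rewrite -lerBlDl -mulrBr; apply: le_trans (ler_norm _) _.
  rewrite normrM ler_pM //.
  have := @norm_sieve_v r e r0; have := @norm_sieve_v r e' r0.
  rewrite /w; move: (sieve_v r e) (sieve_v r e') => x y h3 h4; rewrite !normrM !normr_nat natrX expr2.
  have : e%:R <= r%:R :> R by rewrite ler_nat -ltnS.
  have : e'%:R <= r%:R :> R by rewrite ler_nat -ltnS.
  move=> h2 h1; rewrite ler_pM // ?mulr_ge0 //.
    by rewrite -[leRHS]mulr1 ler_pM.
  by rewrite -[leRHS]mulr1 ler_pM.
under eq_bigr => e _ do rewrite big_split /= -mulr_sumr sumr_const card_ord.
rewrite big_split /= -mulr_sumr sieve_quadratic // lerD2l.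
rewrite sumr_const card_ord -mulrnA -[leLHS]mulr_natr mulrAC ler_wpM2r ?invr_ge0 //.
by rewrite -natrM ler_nat; nia.
Qed.

End Sieve.

(** * Chebyshev and Mertens upper bounds *)

Section Mertens.
Context {R : realType}.
Implicit Types (a b k m n p : nat) (u v w x y : R).

Lemma ler_sum_seq (T : eqType) (s t : seq T) (F : T -> R) :
  uniq s -> uniq t -> {subset s <= t} -> (forall i, 0 <= F i) ->
  \sum_(i <- s) F i <= \sum_(i <- t) F i.
Proof.
move=> us ut st F0; rewrite [leRHS](bigID (mem s)) /= -[X in _ <= X + _]big_filter.
rewrite [X in _ <= X + _](perm_big s) /=; first by rewrite lerDl sumr_ge0.
apply: uniq_perm; rewrite ?filter_uniq // => i; rewrite mem_filter /=.
by apply: andb_idr => /st.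
Qed.

(** A Brun-Titchmarsh bound, valid for arbitrarily short intervals, which is what narrow windows for
    f lead to. *)
Lemma sum_prime_inv_interval a b : (2 <= a)%N -> (a <= b)%N ->
  \sum_(a <= p < b.+1 | prime p) (p%:R^-1 : R) <=
    16 * (ln (b%:R / a%:R) / ln a%:R) + 16 * expR (- (ln a%:R / 2)).
Proof.
move=> a2 ab; have aR : 1 < a%:R :> R by rewrite ltr1n.
have a0 : 0 < a%:R :> R by lra.
have la : 0 < ln (a%:R : R) by rewrite ln_gt0.
(* With r close to a^(1/8), (r + 1)^4 / a <= (2 x)^4 / a = 16 a^(-1/2), while G(r) >= ln(x) / 2 =
   ln(a) / 16. *)
pose x : R := expR (ln a%:R / 8); pose r := Num.truncn x.
have x1 : 1 <= x by rewrite -expR0 ler_expR divr_ge0 // ltW.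
have /andP[rx xr] := truncn_itv (le_trans ler01 x1); rewrite -/r in rx xr.
have r0 : (0 < r)%N by rewrite /r truncn_gt0.
have xa : x < a%:R by rewrite -[ltRHS]lnK ?posrE // ltr_expR; lra.
have ra : (r < a)%N by rewrite -(ltr_nat R); apply: le_lt_trans xa.
apply: le_trans (sieve_bound r0 ra ab) _; apply: lerD.
  have lba : 0 <= ln (b%:R / a%:R : R).
    by rewrite ln_ge0 // ler_pdivlMr // mul1r ler_nat.
  have G : ln a%:R <= 16 * sieve_mass r :> R.
    have := @harm_le_sieve_mass R r; have := @ln_le_harm R r.
    have : ln x <= ln r.+1%:R by rewrite ler_ln ?posrE ?ltr0n //; lra.
    rewrite /x expRK; move: (ln r.+1%:R) => u; lra.
  have G0 : 0 < sieve_mass r :> R by exact: sieve_mass_gt0.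
  rewrite mulrCA ler_wpM2l // -[leRHS]invrK lef_pV2 ?posrE ?invr_gt0 ?mulr_gt0 ?invr_gt0 //.
  by rewrite invfM invrK ler_pdivrMl.
have -> : 16 * expR (- (ln a%:R / 2)) = (2 * x) ^+ 4 / a%:R :> R.
  rewrite exprMn /x -expRM_natl; have -> : 2 ^+ 4 = 16 :> R by ring.
  rewrite -mulrA; congr (_ * _); rewrite -{3}[a%:R]lnK ?posrE // -expRB; congr expR.
  by field.
rewrite ler_wpM2r ?invr_ge0 // ?natrX lerXn2r ?nnegrE ?ler0n ?mulr_ge0 //; first lra.
by rewrite -natr1; lra.
Qed.

Definition theta n : R := \sum_(0 <= p < n.+1 | prime p) ln p%:R.

Lemma ln_le_2sqrt x : 0 < x -> ln x <= 2 * expR (ln x / 2).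
Proof. by move=> x0; have := expR_ge1Dx (ln x / 2); lra. Qed.

(** Chebyshev's bound by induction from n/2 to n, the primes in (n/2, n] being counted by the
    sieve. *)
Lemma theta_le n : theta n <= 192 * n%:R.
Proof.
elim/ltn_ind: n => n IH.
have [n2|n2] := ltnP n 2.
  rewrite /theta big_nat_cond big1 ?mulr_ge0 // => p /andP[/andP[_ pn] pp].
  by have := prime_gt1 pp; lia.
pose a := (n %/ 2).+1.
have an : (a <= n)%N by rewrite /a; lia.
have a2 : (2 <= a)%N by rewrite /a; lia.
have aR : 2 <= a%:R :> R by rewrite ler_nat.
have nR : n%:R <= 2 * a%:R :> R by rewrite -natrM ler_nat /a; lia.
have n0 : 0 < n%:R :> R by rewrite ltr0n; lia.
have la : 0 < ln (a%:R : R) by rewrite ln_gt0 //; lra.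
rewrite /theta (@big_cat_nat _ _ _ a) //=; last by rewrite (leq_trans an).
have h1 : \sum_(0 <= i < a | prime i) ln i%:R <= 96 * n%:R :> R.
  have /IH : (n %/ 2 < n)%N by lia.
  rewrite /theta -/a => /le_trans; apply.
  have : ((n %/ 2)%N%:R : R) *+ 2 <= n%:R by rewrite -mulrnA ler_nat; lia.
  rewrite mulr2n; lra.
(* 96 = 32 + 64: the main term, with ln(n/a) <= 1, and the remainder, with ln a <= 2 a^(1/2). *)
suff : \sum_(a <= p < n.+1 | prime p) ln p%:R <= 96 * n%:R :> R by move: h1; lra.
apply: (@le_trans _ _ (\sum_(a <= p < n.+1 | prime p) (n%:R * (2 * ln a%:R)) * p%:R^-1 : R)).
  rewrite big_nat_cond [leRHS]big_nat_cond; apply: ler_sum => p /andP[/andP[ap pn] _].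
  have p0 : 0 < p%:R :> R by rewrite ltr0n; lia.
  have pn' : p%:R <= n%:R :> R by rewrite ler_nat.
  have a0 : 0 < a%:R :> R by lra.
  have lp : ln p%:R <= 2 * ln a%:R :> R.
    have -> : 2 * ln a%:R = ln (a%:R * a%:R) :> R.
      by rewrite lnM ?posrE // mulr2n mulrDl mul1r.
    rewrite ler_ln ?posrE ?mulr_gt0 //; apply: (le_trans pn').
    by apply: (le_trans nR); rewrite ler_wpM2r // ltW.
  rewrite ler_pdivlMr // [leRHS]mulrC; apply: ler_pM => //.
  by rewrite ln_ge0 // ler1n; exact: leq_trans ap.
rewrite -mulr_sumr.
apply: le_trans (ler_wpM2l _ (sum_prime_inv_interval a2 an)) _.
  by rewrite mulr_ge0 // mulr_ge0 // ltW.
rewrite -mulrA mulrC; apply: ler_wpM2r; first by rewrite ltW.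
rewrite mulrDr.
have l2 : ln (n%:R / a%:R) <= 1 :> R.
  apply: le_trans (ln_le_subr1 _) _; first by rewrite divr_gt0 //; lra.
  by rewrite lerBlDr ler_pdivrMr; lra.
have -> : 2 * ln a%:R * (16 * (ln (n%:R / a%:R) / ln a%:R)) = 32 * ln (n%:R / a%:R) :> R.
  by field; rewrite gt_eqF.
have := @ln_le_2sqrt (a%:R : R); rewrite ltr0n => /(_ isT).
set e := expR (ln _ / 2) => h.
have e0 : 0 < e by exact: expR_gt0.
have -> : expR (- (ln a%:R / 2)) = e^-1 :> R by rewrite expRN.
have : ln a%:R * e^-1 <= 2 :> R by rewrite ler_pdivrMr.
have -> : 2 * ln a%:R * (16 * e^-1) = 32 * (ln a%:R * e^-1) :> R by ring.
by move: (ln a%:R * e^-1) => z; lra.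
Qed.

Lemma sum_ln_primes_le n : (0 < n)%N -> \sum_(p <- primes n) ln p%:R <= ln n%:R :> R.
Proof.
move=> n0; have pr p : p \in primes n -> (0 < p)%N.
  by rewrite mem_primes => /andP[/prime_gt0].
rewrite -ler_expR lnK ?posrE ?ltr0n // expR_sum.
rewrite big_seq (eq_bigr (fun p => p%:R)) => [|p /pr p0]; last first.
  by rewrite lnK // posrE ltr0n.
rewrite -big_seq -natr_prod ler_nat [leqRHS](prod_prime_decomp n0) prime_decompE.
rewrite big_map /= !big_seq; apply: leq_prod => p hp.
rewrite -[leqLHS]expn1; apply: leq_pexp2l; first exact: pr.
by rewrite logn_gt0.
Qed.

Definition mertens_sum n : R := \sum_(0 <= p < n.+1 | prime p) ln p%:R / p%:R.

(** Double counting of ln p over the pairs p | k with k <= n: for fixed k the primes contribute at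
    most ln k <= ln n. *)
Lemma sum_ln_div_le n :
  \sum_(0 <= p < n.+1 | prime p) (ln p%:R * (n %/ p)%N%:R : R) <= n%:R * ln n%:R.
Proof.
apply: (@le_trans _ _ (\sum_(1 <= k < n.+1) \sum_(p <- primes k) ln p%:R : R)).
  rewrite [leRHS](_ : _ = \sum_(1 <= k < n.+1) \sum_(0 <= p < n.+1)
      (if prime p && (p %| k)%N then ln p%:R else 0 : R)); last first.
    rewrite !big_nat; apply: eq_bigr => k /andP[k0 kn].
    rewrite -big_mkcond -[RHS]big_filter; apply: perm_big.
    apply: uniq_perm; rewrite ?primes_uniq ?filter_uniq ?iota_uniq // => p.
    rewrite mem_primes mem_filter k0 /= -andbA; case: (prime p) => //=.
    rewrite mem_index_iota /=; apply: esym; apply: andb_idr => pk.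
    by rewrite (leq_ltn_trans (dvdn_leq _ pk)).
  rewrite exchange_big /= big_mkcond; apply: ler_sum => p _.
  case: ifP => pp; last by rewrite big1 // lexx.
  rewrite divn_count_dvd natr_sum mulr_sumr; apply: ler_sum => k _ /=.
  by case: ifP => _; rewrite ?mulr1 ?mulr0.
apply: (@le_trans _ _ (\sum_(1 <= k < n.+1) ln n%:R : R)).
  rewrite !big_nat; apply: ler_sum => k /andP[k0 kn].
  apply: le_trans (sum_ln_primes_le k0) _.
  by rewrite ler_ln ?posrE ?ltr0n ?ler_nat // (leq_trans k0).
by rewrite sumr_const_nat subn1 /= mulr_natl.
Qed.

(** Replacing n/p by its integer part loses less than 1 for each prime, hence at most [theta n] in
    total. *)
Lemma mertens_sum_le n : (0 < n)%N -> mertens_sum n <= ln n%:R + 192.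
Proof.
move=> n0; have nR : 0 < n%:R :> R by rewrite ltr0n.
rewrite -(ler_pM2l nR) mulrDr.
have := sum_ln_div_le n; have := theta_le n => h1 h2.
rewrite [n%:R * 192]mulrC; apply: le_trans (lerD h2 h1).
rewrite /mertens_sum /theta mulr_sumr -big_split /=.
rewrite big_seq_cond [leRHS]big_seq_cond; apply: ler_sum => p /andP[_ pp].
have p0 : 0 < p%:R :> R by rewrite ltr0n prime_gt0.
have l0 : 0 <= ln p%:R :> R by rewrite ln_ge0 // ler1n prime_gt0.
rewrite -[X in _ <= _ + X]mulr1 -mulrDr mulrCA ler_wpM2l //.
rewrite ler_pdivrMr // natr1 -natrM ler_nat ltnW // mulnC.
by rewrite mulnC ltn_ceil // prime_gt0.
Qed.

(* Summation by parts: X(n) = sum_(p <= n) 1/p - A(n)/ln n only moves through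
   the variation of 1/ln, because the jump at a prime cancels. *)
Lemma sum_prime_inv_le n : (2 <= n)%N ->
  \sum_(0 <= p < n.+1 | prime p) (p%:R^-1 : R) <=
    ln (ln n%:R) + (1 - ln (ln 2) + 192 / ln 2).
Proof.
move=> n2; have ln2 : 0 < ln (2 : R) by rewrite ln_gt0 //; lra.
have key : \sum_(0 <= p < n.+1 | prime p) (p%:R^-1 : R) - mertens_sum n / ln n%:R
   <= ln (ln n%:R) - ln (ln 2) + 192 * ((ln 2)^-1 - (ln n%:R)^-1).
  elim: n n2 => [//|n IH] /=; rewrite leq_eqVlt => /orP[/eqP nE|n2].
    rewrite -nE !subrr mulr0 addr0 /mertens_sum.
    have S (F : nat -> R) : \sum_(0 <= p < 3 | prime p) F p = F 2%N.
      by rewrite big_mkcond !big_nat_recr //= big_geq // !add0r.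
    rewrite !S.
    by rewrite mulrAC divff ?mul1r ?subrr // gt_eqF.
  have {}IH := IH n2.
  have l0 : 0 < ln (n%:R : R) by rewrite ln_gt0 // ltr1n.
  have l1 : 0 < ln (n.+1%:R : R) by rewrite ln_gt0 // ltr1n; lia.
  have l01 : ln (n%:R : R) <= ln n.+1%:R.
    by rewrite ler_ln ?posrE ?ltr0n ?ler_nat //; lia.
  have : \sum_(0 <= p < n.+2 | prime p) (p%:R^-1 : R) - mertens_sum n.+1 / ln n.+1%:R
     = \sum_(0 <= p < n.+1 | prime p) (p%:R^-1 : R) - mertens_sum n / ln n.+1%:R.
    rewrite /mertens_sum !(big_mkcond prime) /= !(@big_nat_recr _ _ _ n.+1) //=.
    case: ifP => _; last by rewrite !addr0.
    rewrite mulrDl [_ / _ / _]mulrAC divff ?gt_eqF // mul1r.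
    by rewrite opprD addrACA subrr addr0.
  move=> ->.
  have A := @mertens_sum_le n; have {}A := A (ltn_trans (ltn0Sn 0) n2).
  have i01 : (ln (n.+1%:R : R))^-1 <= (ln (n%:R : R))^-1 by rewrite lef_pV2 ?posrE.
  have lg : 1 - ln n%:R / ln n.+1%:R <= ln (ln n.+1%:R) - ln (ln n%:R) :> R.
    rewrite -ln_div ?posrE //; apply: le_trans (ln_ge_1subV _); first by rewrite invf_div.
    by rewrite divr_gt0.
  have lk : ln n%:R / ln n%:R = 1 :> R by rewrite divff // gt_eqF.
  move: IH lg lk i01 A; move: (ln (ln _)) (ln (ln _)).
  move: (ln n.+1%:R)^-1 (ln n%:R)^-1 => u v lu lv IH lg lk uv A.
  nra.
have l0 : 0 < ln (n%:R : R) by rewrite ln_gt0 // ltr1n.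
have := @mertens_sum_le n; rewrite (ltn_trans _ n2) // => /(_ isT) A.
have : mertens_sum n / ln n%:R <= 1 + 192 / ln n%:R.
  by rewrite -[X in X + _](@divff _ (ln (n%:R : R))) ?gt_eqF // -mulrDl ler_wpM2r // invr_ge0 ltW.
by move: key; move: (ln _)^-1 => u; lra.
Qed.

(** The exponential of the constant in [sum_prime_inv_le], as it appears when the sum of 1/p is
    exponentiated. *)
Definition mertens_bound : R := expR (1 - ln (ln 2) + 192 / ln 2).

Lemma mertens_bound_ge1 : 1 <= mertens_bound.
Proof.
rewrite -expR0 ler_expR; have ln2 : 0 < ln (2 : R) by rewrite ln_gt0 //; lra.
have : ln (ln 2) <= ln (2 : R) - 1 by exact: ln_le_subr1.
have : ln 2 <= 2 - 1 :> R by exact: ln_le_subr1.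
have : 0 <= 192 / ln 2 :> R by rewrite divr_ge0 ?ler0n // ltW.
move: (_ / _) => u; lra.
Qed.

(** Primes are placed on the scale of ln p. For v = 0 these are all the primes up to exp(w), as ln p
    > 0. *)
Definition log_primes v w : seq nat :=
  [seq p <- iota 0 (Num.truncn (expR w)).+1 | prime p && (v < ln p%:R <= w)].

Lemma mem_log_primes v w p : (p \in log_primes v w) = prime p && (v < ln p%:R <= w).
Proof.
rewrite mem_filter mem_iota /= add0n ltnS; apply: andb_idr => /andP[pp /andP[_ pw]].
rewrite truncn_ge_nat ?expR_ge0 // -[leLHS]lnK ?ler_expR //.
by rewrite posrE ltr0n prime_gt0.
Qed.

Lemma log_primes_uniq v w : uniq (log_primes v w).
Proof. by rewrite filter_uniq ?iota_uniq. Qed.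

Lemma log_primes_cat u v w : u <= v -> v <= w ->
  perm_eq (log_primes u w) (log_primes u v ++ log_primes v w).
Proof.
move=> uv vw; apply: uniq_perm.
- exact: log_primes_uniq.
- rewrite cat_uniq !log_primes_uniq andbT /=; apply/hasPn => p.
  rewrite !mem_log_primes => /andP[-> /andP[vp _]] /=.
  by rewrite negb_and -!ltNge vp orbT.
- move=> p; rewrite mem_cat !mem_log_primes -andb_orr; congr (_ && _).
  have [pv|vp] := leP (ln p%:R) v; first by rewrite orbF (le_trans pv vw) andbT.
  by rewrite andbF (le_lt_trans uv vp).
Qed.

(** The selected primes lie between their extremes a and b, and ln(b/a) <= r ln a, so the factor 1 /
    ln a of the sieve bound cancels. *)
Lemma sum_log_primes_window v w (P : pred nat) (r : R) : 0 <= v -> 0 <= r ->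
  (forall p q : nat, p \in log_primes v w -> q \in log_primes v w -> P p -> P q ->
     ln q%:R <= ln p%:R * (1 + r)) ->
  \sum_(p <- log_primes v w | P p) (p%:R^-1 : R) <= 16 * r + 16 * expR (- (v / 2)).
Proof.
move=> v0 r0 H; rewrite -big_filter.
set s := [seq p <- log_primes v w | P p].
have E0 := expR_gt0 (- (v / 2)).
have [s0|] := eqVneq s [::]; first by rewrite s0 big_nil; lra.
rewrite -size_eq0 -lt0n -has_predT => /hasP[p0 p0s _].
have exs : exists p, p \in s by exists p0.
have [a sa amin] := ex_minnP exs.
have bnd p : p \in s -> (p <= Num.truncn (expR w))%N.
  by rewrite !mem_filter mem_iota => /and3P[_ _ /andP[_]]; rewrite add0n ltnS.
have [b sb bmax] := ex_maxnP exs bnd.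
have Ms p : p \in s -> P p /\ p \in log_primes v w.
  by rewrite mem_filter => /andP[].
have [Pa la] := Ms _ sa; have [Pb lb] := Ms _ sb.
have pa : prime a by move: la; rewrite mem_log_primes => /andP[].
have a2 := prime_gt1 pa.
have ab : (a <= b)%N by exact: amin.
have aR : 1 < a%:R :> R by rewrite ltr1n.
have bR : 0 < b%:R :> R by rewrite ltr0n (leq_trans _ ab) // prime_gt0.
have lna : 0 < ln (a%:R : R) by rewrite ln_gt0.
apply: (@le_trans _ _ (\sum_(a <= p < b.+1 | prime p) (p%:R^-1 : R))).
  rewrite -[leRHS]big_filter; apply: ler_sum_seq.
  - by rewrite filter_uniq // log_primes_uniq.
  - by rewrite filter_uniq // iota_uniq.
  - move=> p ps; rewrite mem_filter mem_index_iota ltnS amin // bmax // !andbT.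
    by have [_] := Ms _ ps; rewrite mem_log_primes => /andP[].
  - by move=> p; rewrite invr_ge0.
apply: le_trans (sum_prime_inv_interval a2 ab) _; apply: lerD.
  rewrite ler_wpM2l // ler_pdivrMr // ln_div ?posrE //; last by lra.
  by have := H _ _ la lb Pa Pb; rewrite mulrDr; lra.
rewrite ler_wpM2l // ler_expR; move: la; rewrite mem_log_primes => /and3P[_ + _]; lra.
Qed.

(** For distinct primes, expanding the product gives the sum of 1/a over the squarefree a composed
    of primes of s. *)
Definition mass (s : seq nat) : R := \prod_(p <- s) (1 + p%:R^-1).

Lemma mass_ge1 s : 1 <= mass s.
Proof.
rewrite /mass; elim/big_ind: _ => // [x y x1 y1|p _].
  by rewrite -[leLHS]mulr1 ler_pM.
by rewrite lerDl invr_ge0.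
Qed.

Lemma mass_cat s t : mass (s ++ t) = mass s * mass t.
Proof. by rewrite /mass big_cat. Qed.

Lemma mass_perm s t : perm_eq s t -> mass s = mass t.
Proof. by move=> st; rewrite /mass (perm_big t). Qed.

Lemma mass_le w : 1 <= w -> mass (log_primes 0 w) <= mertens_bound * w.
Proof.
move=> w1.
apply: (@le_trans _ _ (expR (\sum_(p <- log_primes 0 w) p%:R^-1))).
  rewrite expR_sum /mass; apply: ler_prod => p _.
  by rewrite addr_ge0 ?invr_ge0 //= expR_ge1Dx.
pose n := Num.truncn (expR w).
have n2 : (2 <= n)%N.
  rewrite truncn_ge_nat ?expR_ge0 //; have := expR_ge1Dx w; lra.
have nw : ln n%:R <= w.
  rewrite -[leRHS]expRK ler_ln ?posrE ?expR_gt0 ?ltr0n //; last by lia.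
  by rewrite truncn_le expR_ge0.
have ln0 : 0 < ln (n%:R : R) by rewrite ln_gt0 // ltr1n.
have w0 : 0 < w by lra.
rewrite -[X in _ * X]lnK ?posrE // /mertens_bound -expRD ler_expR.
apply: (@le_trans _ _ (\sum_(0 <= p < n.+1 | prime p) (p%:R^-1 : R))).
  rewrite -[leRHS]big_filter; apply: ler_sum_seq.
  - exact: log_primes_uniq.
  - by rewrite filter_uniq // iota_uniq.
  - by move=> p; rewrite !mem_filter => /andP[/andP[-> _]].
  - by move=> p; rewrite invr_ge0.
apply: le_trans (sum_prime_inv_le n2) _; rewrite addrC lerD2l.
by rewrite ler_ln ?posrE.
Qed.

End Mertens.

(** * Weighted sums over subsets of primes *)

Section SubsetSums.
Context {R : realType}.
Variable f : nat -> R.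
Implicit Types (s t u : seq nat) (g h : R -> R) (a x y : R).

(* Over all subsets A of [s], the sum of g(f(A)) / prod A, where f(A) is the
   sum of the values of [f] on A. *)
Fixpoint subset_sum s g : R :=
  if s is p :: s' then subset_sum s' g + p%:R^-1 * subset_sum s' (fun x => g (x + f p))
  else g 0.

Lemma subset_sum_ge0 s g : (forall x, 0 <= g x) -> 0 <= subset_sum s g.
Proof.
elim: s g => [|p s IH] g g0 /=; first exact: g0.
by rewrite addr_ge0 ?mulr_ge0 ?invr_ge0 ?IH // => x; apply: g0.
Qed.

Lemma le_subset_sum s g h : (forall x, g x <= h x) -> subset_sum s g <= subset_sum s h.
Proof.
elim: s g h => [|p s IH] g h gh /=; first exact: gh.
by rewrite lerD ?ler_wpM2l ?invr_ge0 ?IH.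
Qed.

Lemma eq_subset_sum s g h : g =1 h -> subset_sum s g = subset_sum s h.
Proof. by move=> /funext ->. Qed.

Lemma subset_sum_const s a : subset_sum s (fun=> a) = a * mass s.
Proof.
elim: s => [|p s IH] /=; first by rewrite /mass big_nil mulr1.
by rewrite IH /mass big_cons; ring.
Qed.

Lemma subset_sumD s g h :
  subset_sum s (fun x => g x + h x) = subset_sum s g + subset_sum s h.
Proof. by elim: s g h => [//|p s IH] g h /=; rewrite !IH mulrDr addrACA. Qed.

Lemma subset_sumZ s g a : subset_sum s (fun x => a * g x) = a * subset_sum s g.
Proof. by elim: s g => [//|p s IH] g /=; rewrite !IH; ring. Qed.

Lemma subset_sum_sum s t (G : nat -> R -> R) :
  subset_sum s (fun x => \sum_(p <- t) G p x) = \sum_(p <- t) subset_sum s (G p).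
Proof.
elim: t => [|p t IH].
  rewrite big_nil -[RHS](mul0r (mass s)) -subset_sum_const.
  by apply: eq_subset_sum => x; rewrite big_nil.
rewrite big_cons -IH -subset_sumD; apply: eq_subset_sum => x.
by rewrite big_cons.
Qed.

Lemma subset_sum_le_mass s g a : (forall x, g x <= a) -> subset_sum s g <= a * mass s.
Proof. by move=> ga; rewrite -subset_sum_const; apply: le_subset_sum. Qed.

Lemma subset_sum_cat s t g :
  subset_sum (s ++ t) g = subset_sum s (fun x => subset_sum t (fun y => g (x + y))).
Proof.
elim: s g => [|p s IH] g /=; first by apply: eq_subset_sum => x; rewrite add0r.
rewrite !IH; congr (_ + _ * _); apply: eq_subset_sum => x.
by apply: eq_subset_sum => y; rewrite addrAC.
Qed.

Lemma subset_sum_swap s t (G : R -> R -> R) :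
  subset_sum s (fun x => subset_sum t (G x)) =
  subset_sum t (fun y => subset_sum s (G ^~ y)).
Proof.
elim: s G => [//|p s IH] G /=.
by rewrite subset_sumD subset_sumZ IH (IH (fun x => G (x + f p))).
Qed.

Lemma subset_sum_perm s t g : perm_eq s t -> subset_sum s g = subset_sum t g.
Proof.
move=> st; apply: (@catCA_perm_ind _ (fun t => subset_sum s g = subset_sum t g) _ s t st) => //.
move=> s1 s2 s3 ->; rewrite !subset_sum_cat.
under eq_subset_sum do rewrite subset_sum_cat.
rewrite subset_sum_swap; apply: eq_subset_sum => x; rewrite subset_sum_cat.
by do 2!apply: eq_subset_sum => ?; rewrite addrCA.
Qed.

Lemma subset_sum_cons_ge s p g : (forall x, 0 <= g x) ->
  subset_sum s g <= subset_sum (p :: s) g.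
Proof. by move=> g0 /=; rewrite lerDl mulr_ge0 ?invr_ge0 ?subset_sum_ge0. Qed.

(** A nonempty subset is charged to one of its elements p; letting the rest run over all subsets of
    t only increases the sum, as g >= 0. *)
Lemma subset_sum_le_nonempty t g : (forall x, 0 <= g x) ->
  subset_sum t g <= g 0 +
    \sum_(p <- t) p%:R^-1 * subset_sum t (fun x => g (x + f p)).
Proof.
elim: t g => [|q t IH] g g0; first by rewrite big_nil addr0.
rewrite big_cons addrCA addrC [subset_sum (q :: t) g]/=.
apply: lerD; last first.
  by rewrite ler_wpM2l ?invr_ge0 //; apply: subset_sum_cons_ge => x.
apply: le_trans (IH g g0) _; rewrite lerD2l; apply: ler_sum => p _.
by rewrite ler_wpM2l ?invr_ge0 //; apply: subset_sum_cons_ge => x.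
Qed.

(* Removing one element of [t] from the subsets that meet [t]. *)
Lemma subset_sum_block s t g : (forall x, 0 <= g x) ->
  subset_sum (s ++ t) g <= subset_sum s g +
    subset_sum (s ++ t) (fun x => \sum_(p <- t) p%:R^-1 * g (x + f p)).
Proof.
move=> g0; rewrite !subset_sum_cat -subset_sumD; apply: le_subset_sum => x.
apply: le_trans (subset_sum_le_nonempty _ _) _ => //.
rewrite addr0 lerD2l subset_sum_sum le_eqVlt; apply/orP; left; apply/eqP.
apply: eq_bigr => p _; rewrite -subset_sumZ; apply: eq_subset_sum => y.
by rewrite addrA.
Qed.

End SubsetSums.

(** * Decoupling the exact prime factors in logarithmic sums *)

Section LogSums.
Context {R : realType}.
Implicit Types (s : seq nat) (m n p N : nat).

Lemma ler_sum_seq_inj (s t : seq nat) (h : nat -> nat) (F G : nat -> R) :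
  uniq s -> uniq t -> {in s &, injective h} ->
  (forall i, i \in s -> h i \in t /\ F i <= G (h i)) -> (forall j, 0 <= G j) ->
  \sum_(i <- s) F i <= \sum_(j <- t) G j.
Proof.
move=> us ut hinj H G0.
apply: (@le_trans _ _ (\sum_(j <- map h s) G j)).
  by rewrite big_map !big_seq; apply: ler_sum => i /H[].
apply: ler_sum_seq => //; first by rewrite map_inj_in_uniq.
by move=> _ /mapP[i /H[? _] ->].
Qed.

Lemma ler_sum_quotient d N N' (P Q : pred nat) (F G : nat -> R) : (0 < d)%N ->
  (forall m, (0 < m)%N -> (d * m <= N)%N -> P (d * m)%N ->
     [/\ (m <= N')%N, Q m & F (d * m)%N <= G m]) ->
  (forall n, (0 < n <= N)%N -> P n -> (d %| n)%N) -> (forall j, 0 <= G j) ->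
  \sum_(1 <= n < N.+1 | P n) F n <= \sum_(1 <= m < N'.+1 | Q m) G m.
Proof.
move=> d0 H dv G0; rewrite -big_filter -[leRHS]big_filter.
have ms n : n \in [seq i <- index_iota 1 N.+1 | P i] ->
    exists m, [/\ n = (d * m)%N, (0 < m)%N, (d * m <= N)%N & P (d * m)%N].
  rewrite mem_filter mem_index_iota ltnS => /andP[Pn nN].
  have /dvdnP[m nE] := dv _ nN Pn; exists m; move: nN Pn; rewrite nE mulnC.
  by rewrite muln_gt0 => /andP[/andP[]].
apply: (@ler_sum_seq_inj _ _ (fun n => n %/ d)%N).
- by rewrite filter_uniq // iota_uniq.
- by rewrite filter_uniq // iota_uniq.
- move=> x y /ms[m [-> _ _ _]] /ms[k [-> _ _ _]].
  by rewrite !mulKn // => ->.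
- move=> n /ms[m [-> m0 dm Pm]]; rewrite mulKn //.
  have [h1 h2 h3] := H _ m0 dm Pm; split=> //.
  by rewrite mem_filter mem_index_iota h2 m0 ltnS.
- exact: G0.
Qed.

Lemma ler_sum_widen N N' (P Q : pred nat) (F : nat -> R) : (N <= N')%N ->
  (forall n, P n -> Q n) -> (forall j, 0 <= F j) ->
  \sum_(1 <= n < N.+1 | P n) F n <= \sum_(1 <= n < N'.+1 | Q n) F n.
Proof.
move=> NN' PQ F0; rewrite -big_filter -[leRHS]big_filter.
apply: ler_sum_seq => //; rewrite ?filter_uniq ?iota_uniq // => n.
rewrite !mem_filter !mem_index_iota => /andP[/PQ -> /andP[-> nN]].
exact: leq_trans nN _.
Qed.

(** The cofactor m in n = a m, where a is the product of the primes of s dividing n exactly once.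
    Then a and m are coprime, so f(n) = f(a) + f(m) whatever the values of f at higher prime
    powers. *)
Definition not_exact s m := all (fun p => logn p m != 1%N) s.

Lemma not_exactM s p e m : prime p -> all prime s -> p \notin s -> (0 < m)%N ->
  not_exact s (p ^ e * m)%N = not_exact s m.
Proof.
move=> pp sp ps m0; apply: eq_in_all => q qs.
have pe0 : (0 < p ^ e)%N by rewrite expn_gt0 prime_gt0.
rewrite lognM //.
rewrite lognX logn_prime //.
have -> : (q == p) = false by apply: contraNF ps => /eqP <-.
by rewrite muln0.
Qed.

(** The primes of s are split off one at a time. The inequality comes from dropping the conditions
    that a and m are coprime and that a m <= N. *)
Lemma log_sum_le_not_exact (f : nat -> R) s (g : R -> R) N :
  additive_function f -> uniq s -> all prime s -> (forall x, 0 <= g x) ->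
  \sum_(1 <= n < N.+1) n%:R^-1 * g (f n) <=
  \sum_(1 <= m < N.+1 | not_exact s m)
    m%:R^-1 * subset_sum f s (fun x => g (f m + x)).
Proof.
move=> addf; elim: s => [|p s IH] us sp g0.
  by rewrite /= le_eqVlt; apply/orP; left; apply/eqP/eq_bigr => n _; rewrite addr0.
move: us sp => /= /andP[ps us] /andP[pp sp].
apply: le_trans (IH us sp g0) _.
pose K y := subset_sum f s (fun x => g (y + x)).
have K0 y : 0 <= K y by apply: subset_sum_ge0.
under [leRHS]eq_bigr => m _.
  rewrite (_ : _ + _ = K (f m) + p%:R^-1 * K (f m + f p)); last first.
    by congr (_ + _ * _); apply: eq_subset_sum => x; rewrite addrAC addrA.
  rewrite mulrDr; over.
rewrite big_split /= (bigID (fun m => logn p m == 1%N)) /= addrC.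
have p0 := prime_gt0 pp.
apply: lerD.
  rewrite le_eqVlt; apply/orP; left; apply/eqP.
  by apply: eq_bigl => m; rewrite andbC.
apply: (@ler_sum_quotient p) => //.
- move=> m m0 pmN /andP[]; rewrite -{1 2}(expn1 p) not_exactM // => Ms.
  rewrite lognM // logn_prime // eqxx expn1 => /eqP[]; rewrite add0n => lm.
  have pm : ~~ (p %| m)%N.
    apply/negP => pm; have : (0 < logn p m)%N by rewrite logn_gt0 mem_primes pp m0.
    by rewrite lm.
  split; first by apply: leq_trans pmN; rewrite leq_pmull.
    by rewrite lm.
  rewrite addf // ?prime_coprime // natrM invfM [_^-1 * m%:R^-1]mulrC -mulrA.
  by rewrite [f p + _]addrC.
- move=> n /andP[n0 _] /andP[_ /eqP ln].
  have : p \in primes n by rewrite -logn_gt0 ln.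
  by rewrite mem_primes => /and3P[].
- by move=> j; rewrite !mulr_ge0 ?invr_ge0.
Qed.

Definition not_exact_sum s N : R := \sum_(1 <= m < N.+1 | not_exact s m) m%:R^-1.

(** Let X be the part with p not dividing m. The other m are multiples of p^2 and add at most p^-2
    times the sum for s; and X (1 + 1/p) counts the distinct integers m and p m, which requires the
    longer range p N. *)
Lemma not_exact_sum_cons s p N : prime p -> all prime s -> p \notin s ->
  not_exact_sum (p :: s) N * (1 + p%:R^-1) <=
  (1 + 2 * (p ^ 2)%N%:R^-1) * not_exact_sum s (p * N).
Proof.
move=> pp sp ps; have p0 := prime_gt0 pp.
have pR : 0 < p%:R :> R by rewrite ltr0n.
pose X := \sum_(1 <= m < N.+1 | not_exact s m && ~~ (p %| m)%N) (m%:R^-1 : R).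
have ge0 (P : pred nat) M : 0 <= \sum_(1 <= m < M | P m) (m%:R^-1 : R).
  by apply: sumr_ge0 => i _; rewrite invr_ge0.
have mono : not_exact_sum s N <= not_exact_sum s (p * N).
  by apply: ler_sum_widen => [|//|j]; rewrite ?invr_ge0 // leq_pmull.
have h1 : not_exact_sum (p :: s) N <= X + (p ^ 2)%N%:R^-1 * not_exact_sum s N.
  rewrite /not_exact_sum (bigID (fun m => p %| m)%N) /= addrC; apply: lerD.
    rewrite /X [leLHS]big_mkcond [leRHS]big_mkcond /=; apply: ler_sum => m _.
    case: ifP => [/andP[/andP[_ ->] ->] //|_]; by case: ifP => _ //; rewrite invr_ge0.
  rewrite mulr_sumr; apply: (@ler_sum_quotient (p ^ 2)%N).
  - by rewrite expn_gt0 p0.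
  - move=> m m0 mN /andP[/andP[_]]; rewrite not_exactM // => Ms _; split=> //.
      by apply: leq_trans mN; rewrite leq_pmull // expn_gt0 p0.
    by rewrite [X in X <= _](_ : _ = (p ^ 2)%N%:R^-1 * m%:R^-1) // natrM invfM.
  - move=> n /andP[n0 _] /andP[/andP[l1 _] pn]; rewrite pfactor_dvdn //.
    have : (0 < logn p n)%N by rewrite logn_gt0 mem_primes pp n0.
    by move: l1; lia.
  - by move=> j; rewrite mulr_ge0 ?invr_ge0.
have h2 : X * (1 + p%:R^-1) <= not_exact_sum s (p * N).
  rewrite mulrDr mulr1 /not_exact_sum [leRHS](bigID (fun m => p %| m)%N) /= [leRHS]addrC.
  apply: lerD.
    by apply: ler_sum_widen => [|//|j]; rewrite ?invr_ge0 // leq_pmull.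
  rewrite /X mulr_suml -[leLHS]big_filter -[leRHS]big_filter.
  apply: (@ler_sum_seq_inj _ _ (fun n => p * n)%N).
  - by rewrite filter_uniq // iota_uniq.
  - by rewrite filter_uniq // iota_uniq.
  - by move=> x y _ _ /eqP; rewrite eqn_pmul2l // => /eqP.
  - move=> m; rewrite !mem_filter !mem_index_iota => /andP[/andP[Ms _] /andP[m0 mN]].
    rewrite dvdn_mulr // andbT -{1}(expn1 p) not_exactM // Ms muln_gt0 p0 m0 /=.
    rewrite ltnS leq_pmul2l // -ltnS mN; split=> //.
    by rewrite natrM invfM mulrC.
  - by move=> j; rewrite invr_ge0.
have i1 : p%:R^-1 <= 1 :> R by rewrite invf_le1 // ler1n.
have i0 : 0 <= p%:R^-1 :> R by rewrite invr_ge0 ltW.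
have Z0 : 0 <= not_exact_sum s N by exact: ge0.
have q0 : 0 <= (p ^ 2)%N%:R^-1 :> R by rewrite invr_ge0.
have := ler_wpM2r (addr_ge0 ler01 i0) h1.
clear h1; clearbody X; move: h2 mono i1 i0 Z0 q0; move: (p%:R^-1) (p ^ 2)%N%:R^-1 => i q.
move: (not_exact_sum s (p * N)) (not_exact_sum s N) (not_exact_sum (p :: s) N) X => Z1 Z2 Z3 X'.
move=> h2 mono i1 i0 Z0 q0 /le_trans; apply; rewrite mulrDl.
have : q * Z2 * (1 + i) <= 2 * q * Z1.
  have -> : q * Z2 * (1 + i) = q * (Z2 * (1 + i)) by ring.
  have -> : 2 * q * Z1 = q * (2 * Z1) by ring.
  rewrite ler_wpM2l //; nra.
by rewrite mulrDl mul1r; lra.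
Qed.

(** exp(4) bounds the product of the factors 1 + 2/p^2, as the sum of n^-2 is at most 2. The range
    grows by a factor independent of N, hence negligible against ln N. *)
Lemma not_exact_sum_le s N : uniq s -> all prime s ->
  not_exact_sum s N * mass s <= expR 4 * harm (\prod_(p <- s) p * N)%N.
Proof.
move=> us sp.
apply: (@le_trans _ _ (expR (2 * \sum_(p <- s) (p ^ 2)%N%:R^-1) *
                       harm (\prod_(p <- s) p * N)%N)).
  elim: s us sp N => [_ _ N|p s IH] /=.
    rewrite /mass !big_nil mul1n mulr0 expR0 mul1r mulr1 /not_exact_sum /harm.
    by rewrite -(big_mkord xpredT (fun n => n%:R^-1 : R)) big_nat_recl //= invr0 add0r big_add1.
  move=> /andP[ps us] /andP[pp sp] N.
  rewrite !big_cons /mass big_cons -/(mass s) mulrA.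
  apply: le_trans (ler_wpM2r _ (not_exact_sum_cons N pp sp ps)) _.
    by apply: le_trans (mass_ge1 _).
  rewrite -mulrA; apply: le_trans (ler_wpM2l _ (IH us sp _)) _.
    by rewrite addr_ge0 // mulr_ge0 // invr_ge0.
  rewrite mulrA [(_ * \prod_(j <- s) j)%N]mulnC -mulnA ler_wpM2r //.
    by apply: sumr_ge0 => i _; rewrite invr_ge0.
  by rewrite mulrDr expRD ler_wpM2r ?expR_ge0 // expR_ge1Dx.
rewrite ler_wpM2r //; first by apply: sumr_ge0 => i _; rewrite invr_ge0.
rewrite ler_expR.
suff : \sum_(p <- s) (p ^ 2)%N%:R^-1 <= 2 :> R by move: (\sum_(_ <- _) _) => u; lra.
pose M := (\max_(p <- s) p)%N.
apply: le_trans (sum_invsq_le M); rewrite -(big_mkord xpredT (fun n => (n ^ 2)%N%:R^-1 : R)).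
apply: ler_sum_seq => //; first exact: iota_uniq.
by move=> p ps; rewrite mem_index_iota ltnS /= /M leq_bigmax_seq.
Qed.

(** Divided by ln N with s fixed, this bounds the logarithmic mean of g(f(n)) by exp(4) B / mass
    s. *)
Lemma log_sum_le (f : nat -> R) s (g : R -> R) (B : R) N :
  additive_function f -> uniq s -> all prime s -> (forall x, 0 <= g x) ->
  (forall y, subset_sum f s (fun x => g (y + x)) <= B) -> (0 < N)%N ->
  \sum_(1 <= n < N.+1) n%:R^-1 * g (f n) <=
  expR 4 * B / mass s * (1 + ln (\prod_(p <- s) p)%N%:R + ln N%:R).
Proof.
move=> addf us sp g0 gB N0.
have B0 : 0 <= B by apply: le_trans (gB 0); apply: subset_sum_ge0.
have m0 : 0 < mass s :> R by apply: lt_le_trans (mass_ge1 s).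
apply: le_trans (log_sum_le_not_exact N addf us sp g0) _.
apply: (@le_trans _ _ (B * not_exact_sum s N)).
  rewrite mulr_sumr; apply: ler_sum => m _.
  by rewrite mulrC ler_wpM2r ?invr_ge0.
have P0 : (0 < \prod_(p <- s) p)%N.
  by rewrite big_seq prodn_cond_gt0 // => p /(allP sp) /prime_gt0.
have := not_exact_sum_le N us sp; rewrite -ler_pdivlMr // => h.
apply: le_trans (ler_wpM2l B0 h) _.
rewrite (_ : B * _ = expR 4 * B / mass s * harm (\prod_(p <- s) p * N)); last by ring.
apply: ler_wpM2l; first by rewrite divr_ge0 ?mulr_ge0 ?expR_ge0 // ltW.
apply: le_trans (harm_le_ln _) _; first by rewrite muln_gt0 P0.
by rewrite natrM lnM ?posrE ?ltr0n // addrA.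
Qed.

End LogSums.

(** * Squarefree numbers without small prime factors *)

Section SquarefreeSums.
Context {R : realType}.
Implicit Types (s : seq nat) (m n p N : nat).

Definition rough_sqfree s d := sqfree d && all (fun p => ~~ (p %| d)%N) s.

Definition sqfree_sum s N : R := \sum_(1 <= d < N.+1 | rough_sqfree s d) d%:R^-1.

Lemma sqfree_sum_cons s p N : prime p ->
  sqfree_sum s N <= (1 + p%:R^-1) * sqfree_sum (p :: s) N.
Proof.
move=> pp; have p0 := prime_gt0 pp.
rewrite mulrDl mul1r {1}/sqfree_sum (bigID (fun d => p %| d)%N) /= addrC.
apply: lerD.
  rewrite le_eqVlt; apply/orP; left; apply/eqP; apply: eq_bigl => d.
  by rewrite /rough_sqfree /= -andbA [_ && ~~ _]andbC.
rewrite /sqfree_sum mulr_sumr; apply: (@ler_sum_quotient _ p) => //.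
- move=> m m0 pmN /andP[/andP[sd ad] _]; split.
  + by rewrite (leq_trans _ pmN) // leq_pmull.
  + have [pm|pm] := boolP (p %| m)%N; first by rewrite sqfreeM_dvd in sd.
    rewrite /rough_sqfree /= pm -(sqfreeMl pp pm) sd /=.
    by apply: sub_all ad => q; apply: contra => qm; rewrite dvdn_mull.
  + by rewrite natrM invfM.
- by move=> n _ /andP[].
Qed.

Lemma sqfree_sum_nil_le s N : all prime s -> sqfree_sum [::] N <= mass s * sqfree_sum s N.
Proof.
elim: s => [_|p s IH /= /andP[pp sp]]; first by rewrite /mass big_nil mul1r.
apply: le_trans (IH sp) _; rewrite /mass big_cons -/(mass s) -mulrA mulrCA ler_wpM2l //.
  by rewrite (le_trans ler01) // mass_ge1.
exact: sqfree_sum_cons.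
Qed.

Lemma harm_le_mass_sqfree s N : all prime s ->
  harm N <= 2 * (mass s * sqfree_sum s N).
Proof.
move=> sp; apply: (@le_trans _ _ (2 * sqfree_sum [::] N)).
  apply: le_trans (harm_le_sqfree N) _; rewrite ler_wpM2l //.
  rewrite -(big_mkord sqfree (fun n => n%:R^-1 : R)) big_mkcond big_nat_recl //= add0r.
  rewrite /sqfree_sum big_mkcond big_add1 /= le_eqVlt; apply/orP; left; apply/eqP.
  by rewrite [RHS]big_mkcond; apply: eq_bigr => d _; rewrite /rough_sqfree /= andbT.
by rewrite ler_wpM2l // sqfree_sum_nil_le.
Qed.

Lemma log_primes_prime (v w : R) : all prime (log_primes v w).
Proof. by apply/allP => p; rewrite mem_log_primes => /andP[]. Qed.

(** For N the integer part of exp(w), only d = 1 is counted by the rough sum up to N, so the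
    harmonic sum is at most twice the mass. *)
Lemma half_le_mass (w : R) : 0 <= w -> w / 2 <= mass (log_primes 0 w).
Proof.
move=> w0; pose N := Num.truncn (expR w).
have N1 : (0 < N)%N by rewrite truncn_gt0 -expR0 ler_expR.
have := @harm_le_mass_sqfree _ N (log_primes_prime 0 w).
have : w <= ln (N.+1%:R : R).
  by rewrite -[leLHS]expRK ler_ln ?posrE ?expR_gt0 ?ltr0n // ltW // truncnS_gt.
have := @ln_le_harm R N.
suff S1 : sqfree_sum (log_primes 0 w) N <= 1.
  have : mass (log_primes 0 w) * sqfree_sum (log_primes 0 w) N <= mass (log_primes 0 w) * 1 :> R.
    by rewrite ler_wpM2l // (le_trans ler01) // mass_ge1.
  by move: (ln _) (harm _) => a b; lra.
rewrite /sqfree_sum big_mkcond big_ltn ?ltnS // big_nat big1 ?addr0 => [|d /andP[d1 dN]].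
  by rewrite /= addr0; case: ifP => _; rewrite ?invr1 ?lexx ?ler01.
case: ifPn => // /andP[_ /allP H]; exfalso.
have pd : prime (pdiv d) by rewrite pdiv_prime.
have : pdiv d \in log_primes 0 w.
  rewrite mem_log_primes pd ln_gt0 ?ltr1n ?prime_gt1 //=.
  rewrite -[leRHS]expRK ler_ln ?posrE ?expR_gt0 ?ltr0n ?prime_gt0 //.
  rewrite -truncn_ge_nat ?expR_ge0 // -/N (leq_trans _ (_ : d <= N)%N) //.
  by apply: dvdn_leq (pdiv_dvd d); lia.
by move=> /H; rewrite pdiv_dvd.
Qed.

End SquarefreeSums.

(** * Concentration on smooth numbers and dyadic blocks *)

Section SmoothConcentration.
Context {R : realType}.
Variables (c : R) (f : nat -> R).
Hypothesis c1 : 1 <= c.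
Hypothesis fp : forall p : nat, prime p -> f p = ln (p%:R : R) `^ (- c).
Implicit Types (u d v w x y V Y : R) (p q : nat).

Let c0 : 0 <= c := le_trans ler01 c1.

Definition window u d x : R := ((u < x) && (x <= u + d))%:R.

Lemma window_ge0 u d x : 0 <= window u d x. Proof. exact: ler0n. Qed.

Lemma window_le1 u d x : window u d x <= 1. Proof. by rewrite lern1 leq_b1. Qed.

Lemma ln_prime_gt0 p : prime p -> 0 < ln (p%:R : R).
Proof. by move=> pp; rewrite ln_gt0 // ltr1n prime_gt1. Qed.

Lemma value_log_primes_le v w p : 0 < v -> p \in log_primes v w ->
  0 <= f p <= v `^ (- c).
Proof.
move=> v0; rewrite mem_log_primes => /and3P[pp vp _].
rewrite fp // powR_ge0 !powRN lef_pV2 ?posrE ?powR_gt0 ?ln_prime_gt0 //.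
by apply: ge0_ler_powR => //; rewrite ?nnegrE ltW // ln_prime_gt0.
Qed.

(* If f(p) and f(q) differ by at most d then (ln q / ln p)^c <= 1 + d w^c, and
   c >= 1 removes the exponent. *)
Lemma sum_window_le v w u d x : 0 <= v -> 0 <= d ->
  \sum_(p <- log_primes v w) p%:R^-1 * window u d (x + f p) <=
  16 * (d * w `^ c) + 16 * expR (- (v / 2)).
Proof.
move=> v0 d0.
rewrite (_ : \sum_(p <- _) _ = \sum_(p <- log_primes v w |
    (u < x + f p) && (x + f p <= u + d)) p%:R^-1); last first.
  rewrite [RHS]big_mkcond; apply: eq_bigr => p _ /=; rewrite /window.
  by case: ifP => _; rewrite ?mulr1 ?mulr0.
apply: sum_log_primes_window => //; first by rewrite mulr_ge0 ?powR_ge0.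
move=> p q; rewrite !mem_log_primes => /andP[pp _] /and3P[qp _ qw].
move=> /andP[_ fpu] /andP[ufq _].
have lp := ln_prime_gt0 pp; have lq := ln_prime_gt0 qp.
have r0 : 0 <= d * w `^ c by rewrite mulr_ge0 ?powR_ge0.
have [h|h] := leP (ln q%:R) (ln p%:R : R).
  by apply: le_trans h _; rewrite mulrDr mulr1 lerDl mulr_ge0 // ltW.
have y1 : 1 <= ln q%:R / ln p%:R :> R by rewrite ler_pdivlMr // mul1r ltW.
rewrite -ler_pdivrMl // mulrC; apply: le_trans (le1r_powR y1 c1) _.
rewrite powRM ?invr_ge0 ?(ltW lq) ?(ltW lp) // -powR_inv1 ?(ltW lp) // -powRrM mulN1r -fp //.
apply: (@le_trans _ _ (ln q%:R `^ c * (f q + d))).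
  by rewrite ler_wpM2l ?powR_ge0 //; lra.
rewrite mulrDr [f q]fp // powRN mulfV ?gt_eqF ?powR_gt0 // lerD2l mulrC.
rewrite ler_wpM2l //; apply: ge0_ler_powR => //; rewrite ?nnegrE.
  exact: ltW.
exact: le_trans (ltW lq) qw.
Qed.

(** At v = w/2 the sieve remainder exp(-v/2) meets a mass of order w; the bound 32 / w is summable
    over halvings of w. *)
Lemma expR_quarter_le x : 0 < x -> expR (- (x / 4)) * x <= 32 / x.
Proof.
move=> x0; have := @expR_ge1Dxn R (x / 4) 1.
rewrite divr_ge0 ?(ltW x0) // => /(_ isT) h.
have {h} : x ^+ 2 / 32 <= expR (x / 4).
  by apply: le_trans h; rewrite (_ : 2`! = 2%N) // expr2; lra.
rewrite ler_pdivlMr // (_ : _ * x * x = expR (- (x / 4)) * x ^+ 2); last by ring.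
by rewrite expRN ler_pdivrMl ?expR_gt0 //; lra.
Qed.

(** 512 = 16 * 32, from the sieve bound and [expR_quarter_le]. *)
Let K : R := 512 * mertens_bound.

Let Mb1 : 1 <= (mertens_bound : R) := mertens_bound_ge1.

Let Mb0 : 0 <= (mertens_bound : R) := le_trans ler01 Mb1.

Let K0 : 0 <= K. Proof. by rewrite mulr_ge0 ?ler0n ?(le_trans ler01 Mb1). Qed.

Let wwc_ge0 d w : 0 <= d -> 0 <= w -> 0 <= d * (w * w `^ c).
Proof. by move=> d0 w0; apply: mulr_ge0 => //; apply: mulr_ge0 => //; exact: powR_ge0. Qed.

(** Induction on the number of halvings of w. Either no prime of (w/2, w] occurs, or removing one
    leaves a factor bounded by the sieve. Passing from w/2 to w frees K / w in the term - K / w,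
    exactly the sieve remainder, and the term in d at least doubles. *)
Lemma smooth_concentration_step w u d : 1 <= w -> 0 <= d ->
  subset_sum f (log_primes 0 w) (window u d) <=
  K * (2 - w^-1) + 2 * K * (d * (w * w `^ c)).
Proof.
move=> w1 d0.
have [n wn] : exists n : nat, w <= 2 ^+ n.
  exists (Num.truncn w).+1; have := truncnS_gt w => /ltW/le_trans; apply.
  by rewrite -natrX ler_nat ltnW // ltn_expl.
elim: n w w1 u wn => [|n IH] w w1 u wn.
  have w0 : 0 < w by lra.
  apply: le_trans (subset_sum_le_mass _ _ (window_le1 u d)) _; rewrite mul1r.
  apply: le_trans (mass_le w1) _.
  have h : 0 <= 2 * K * (d * (w * w `^ c)).
    by apply: mulr_ge0; [move: K0; lra | apply: wwc_ge0; lra].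
  have i1 : w^-1 <= 1 by rewrite invf_le1.
  rewrite expr0 in wn.
  have : K * 1 <= K * (2 - w^-1) by apply: ler_wpM2l => //; lra.
  have : mertens_bound * w <= mertens_bound * 1 :> R by apply: ler_wpM2l; [exact: Mb0 | lra].
  by move: h; move: (2 * K * _) => A; rewrite /K; move: (w^-1) Mb1 => i; lra.
have w0 : 0 < w by lra.
have wc0 : 0 <= d * (w * w `^ c) by apply: wwc_ge0 => //; lra.
have [w2|w2] := leP w 2.
  apply: le_trans (subset_sum_le_mass _ _ (window_le1 u d)) _; rewrite mul1r.
  apply: le_trans (mass_le w1) _.
  have h : 0 <= 2 * K * (d * (w * w `^ c)).
    by apply: mulr_ge0 => //; move: K0; lra.
  have i1 : w^-1 <= 1 by rewrite invf_le1.
  have : K * 1 <= K * (2 - w^-1) by apply: ler_wpM2l => //; lra.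
  have : mertens_bound * w <= mertens_bound * 2 :> R by apply: ler_wpM2l; [exact: Mb0 | lra].
  by move: h; move: (2 * K * _) => A; rewrite /K; move: (w^-1) Mb1 => i; lra.
pose v := w / 2.
have v1 : 1 <= v by rewrite /v; lra.
have vw : v <= w by rewrite /v; lra.
have vn : v <= 2 ^+ n by move: wn; rewrite exprS /v; lra.
rewrite (subset_sum_perm _ _ (log_primes_cat (le_trans ler01 v1) vw)).
apply: le_trans (subset_sum_block _ _ _ (window_ge0 u d)) _.
have H : subset_sum f (log_primes 0 v ++ log_primes v w)
    (fun x => \sum_(p <- log_primes v w) p%:R^-1 * window u d (x + f p))
    <= (16 * (d * w `^ c) + 16 * expR (- (v / 2))) * (mertens_bound * w).
  apply: le_trans (subset_sum_le_mass _ _ (fun x =>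
    sum_window_le w u x (le_trans ler01 v1) d0)) _.
  rewrite -(mass_perm (log_primes_cat (le_trans ler01 v1) vw)).
  apply: ler_wpM2l; last exact: mass_le.
  by apply: addr_ge0; apply: mulr_ge0 => //; rewrite ?expR_ge0 // mulr_ge0 ?powR_ge0.
apply: le_trans (lerD (IH v v1 u vn) H) _.
have e1 : v / 2 = w / 4 by rewrite /v; lra.
have e2 : v^-1 = 2 * w^-1 by rewrite /v invf_div mulrC.
rewrite e1 e2.
have h1 : d * (v * v `^ c) <= (d * (w * w `^ c)) / 2.
  rewrite -mulrA ler_wpM2l // /v mulrAC ler_wpM2r // ler_wpM2l ?(ltW w0) //.
  by apply: ge0_ler_powR => //; rewrite ?nnegrE; lra.
have h2 := expR_quarter_le w0.
set E := expR _ in h2 *; set D := d * (w * _) in wc0 h1 *.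
have -> : (16 * (d * w `^ c) + 16 * E) * (mertens_bound * w) =
   16 * mertens_bound * D + 16 * mertens_bound * (E * w) by rewrite /D; ring.
have h3 : 16 * mertens_bound * (E * w) <= 16 * mertens_bound * (32 / w).
  by apply: ler_wpM2l => //; move: Mb0; lra.
have h4 : 2 * K * (d * (v * v `^ c)) <= 2 * K * (D / 2).
  by apply: ler_wpM2l; [move: K0; lra | exact: h1].
have h5 : 0 <= mertens_bound * D by apply: mulr_ge0 => //; exact: Mb0.
move: h3 h4 h5; rewrite /K; move: (d * (v * _)) (E * w) (w^-1) => x y i.
nra.
Qed.

Lemma smooth_concentration w u d : 1 <= w -> 0 <= d ->
  subset_sum f (log_primes 0 w) (window u d) <=
  2 * K * (1 + d * (w * w `^ c)).
Proof.
move=> w1 d0; apply: le_trans (smooth_concentration_step u w1 d0) _.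
have : 0 <= K * w^-1 by rewrite mulr_ge0 ?invr_ge0 //; lra.
move: K0; rewrite mulrBr mulrDr; lra.
Qed.

(* Subsets of the primes up to exp(Y) with at least one element beyond exp(w),
   the least such element lying in (exp(v), exp(V)]. *)
Lemma concentration_block w v V Y u d : 1 <= w -> w <= v -> v <= V -> V <= Y -> 0 <= d ->
  subset_sum f (log_primes 0 w ++ log_primes v Y) (window u d) <=
  subset_sum f (log_primes 0 w ++ log_primes V Y) (window u d) +
  (16 * (d * V `^ c) + 16 * expR (- (w / 2))) *
  (2 * K * (1 + (d + v `^ (- c)) * (w * w `^ c))) * (2 * mertens_bound * Y / v).
Proof.
move=> w1 wv vV VY d0.
set S := log_primes 0 w; set U := log_primes V Y; set B := log_primes v V.
have vY := le_trans vV VY.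
have v0 : 0 < v by lra.
have Y0 : 0 < Y by lra.
have pU : perm_eq (log_primes v Y) (U ++ B).
  by apply: (perm_trans (log_primes_cat vV VY)); rewrite perm_catC.
have p1 : perm_eq (S ++ log_primes v Y) ((S ++ U) ++ B).
  by rewrite -catA perm_cat2l.
rewrite (subset_sum_perm _ _ p1).
apply: le_trans (subset_sum_block _ _ _ (window_ge0 u d)) _; rewrite lerD2l.
set H := fun x => \sum_(p <- B) _.
(* The smooth primes S become the inner sum, to be bounded uniformly in the contribution of U and
   B. *)
have p2 : perm_eq ((S ++ U) ++ B) ((U ++ B) ++ S) by rewrite -catA perm_catC.
rewrite (subset_sum_perm _ _ p2) subset_sum_cat.
set C1 := 16 * _ + _; set D := v `^ (- c).
have D0 : 0 <= D by exact: powR_ge0.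
have C10 : 0 <= C1.
  by apply: addr_ge0; apply: mulr_ge0 => //; rewrite ?expR_ge0 // mulr_ge0 ?powR_ge0.
(* As 0 <= f p <= D on B, H vanishes outside the window (u - D, u + d]. *)
have HB z : H z <= C1 * window (u - D) (d + D) z.
  rewrite [X in C1 * X]/window; case: (boolP (_ && _)) => [_|hz]; last first.
    rewrite mulr0 /H big_seq big1 // => p pB.
    have /andP[fp0 fpD] := value_log_primes_le v0 pB.
    rewrite /window; case: (boolP (_ && _)) => [/andP[h1 h2]|_]; last by rewrite mulr0.
    by case/negP: hz; apply/andP; split; rewrite /D; lra.
  rewrite mulr1 /H; apply: le_trans (sum_window_le V u z (ltW v0) d0) _.
  by rewrite lerD2l ler_wpM2l // ler_expR; lra.
apply: le_trans (subset_sum_le_mass (a := C1 * (2 * K * (1 + (d + D) * (w * w `^ c)))) _ _ _) _.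
  move=> x; apply: le_trans (le_subset_sum _ _ (fun y => HB (x + y))) _.
  rewrite subset_sumZ ler_wpM2l //.
  rewrite (eq_subset_sum _ _ (h := window (u - D - x) (d + D))).
    by apply: smooth_concentration => //; rewrite addr_ge0.
  by move=> y; rewrite /window; congr (_ && _)%:R; apply/idP/idP; lra.
rewrite ler_wpM2l //.
  apply: mulr_ge0 => //; apply: mulr_ge0; first by move: K0; lra.
  by apply: addr_ge0 => //; apply: wwc_ge0; [exact: addr_ge0 | lra].
(* The mass of (v, Y] is that of (0, Y], at most [mertens_bound] times Y, divided by that of (0, v],
   at least v / 2. *)
rewrite -(mass_perm pU).
have m0 : 0 < mass (log_primes 0 v) :> R by apply: lt_le_trans (mass_ge1 _).
have := mass_le (le_trans w1 (le_trans wv vY)).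
rewrite (mass_perm (log_primes_cat (ltW v0) vY)) mass_cat => h.
rewrite ler_pdivlMr //.
have h2 := half_le_mass (ltW v0).
have h3 : mass (log_primes v Y) * (v / 2) <= mertens_bound * Y :> R.
  by apply: le_trans h; rewrite mulrC ler_wpM2r // (le_trans ler01) // mass_ge1.
by rewrite -/U -/B; move: h3; rewrite mulrA; lra.
Qed.

End SmoothConcentration.

(** * Summation over dyadic blocks *)

Section Concentration.
Context {R : realType}.
Variables (c : R) (f : nat -> R).
Hypothesis c1 : 1 <= c.
Hypothesis fp : forall p : nat, prime p -> f p = ln (p%:R : R) `^ (- c).
Implicit Types (u v w V Y : R) (i n : nat).

Let c0 : 0 <= c := le_trans ler01 c1.

Lemma powR_div (x y z : R) : 0 <= x -> 0 < y -> (x / y) `^ z = x `^ z * y `^ (- z).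
Proof.
move=> x0 y0; rewrite powRM ?invr_ge0 ?(ltW y0) // -powR_inv1 ?(ltW y0) //.
by rewrite -powRrM mulN1r.
Qed.

(** For uniformity in c, (V/Y)^(c-1) and (w/v)^(c-1) are multiplied before V/v <= 2 is used: the 2
    then stays inside (2w/Y)^(c-1), where Y outweighs it. The constant is 768 = 32 * 2 * 3 * 4. *)
Lemma block_term_le (K M w v V Y : R) : 0 <= K -> 0 <= M -> 1 <= w -> w <= v -> v <= V -> V <= 2 * v -> V <= Y ->
  expR (- (w / 2)) = Y^-1 ->
  (16 * (2 * Y `^ (- c) * V `^ c) + 16 * expR (- (w / 2))) *
  (2 * K *
     (1 + (2 * Y `^ (- c) + v `^ (- c)) * (w * w `^ c))) * (2 * M * Y / v)
  <= 768 * K * M * ((V / Y) `^ (c - 1) + (1 + w + 2 * w ^+ 2 * (2 * w / Y) `^ (c - 1)) / V).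
Proof.
move=> K0 M0 w1 wv vV Vv VY ->.
have w0 : 0 < w by lra.
have v0 : 0 < v by lra.
have V0 : 0 < V by lra.
have Y0 : 0 < Y by lra.
have cm1 : 0 <= c - 1 by rewrite subr_ge0.
have cp : 0 < c := lt_le_trans ltr01 c1.
set a := (V / Y) `^ (c - 1); set rho := (2 * w / Y) `^ (c - 1).
pose b := (w / v) `^ c.
have a0 : 0 <= a by exact: powR_ge0.
have b0 : 0 <= b by exact: powR_ge0.
have aE : Y `^ (- c) * V `^ c = V / Y * a.
  by rewrite mulrC -powR_div ?(ltW V0) // -mulr_powRB1 // ?divr_ge0 ?(ltW V0) ?(ltW Y0) //.
have x0 : 0 < w / v by rewrite divr_gt0.
have x1 : w / v <= 1 by rewrite ler_pdivrMr // mul1r.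
have b1 : b <= 1 by rewrite /b -(powRr0 (w / v)) ger_powR // x0 x1.
have x2 : w / v <= 2 * w / V.
  by rewrite ler_pdivrMr // mulrAC ler_pdivlMr //; nra.
have bE : v `^ (- c) * (w * w `^ c) = w * b.
  by rewrite /b powR_div ?(ltW w0) //; ring.
have Yv : Y `^ (- c) <= v `^ (- c).
  rewrite !powRN lef_pV2 ?posrE ?powR_gt0 //.
  by apply: ge0_ler_powR => //; rewrite ?nnegrE; lra.
have ww0 : 0 <= w * w `^ c by rewrite mulr_ge0 ?powR_ge0 // ltW.
have h1 : 16 * (2 * Y `^ (- c) * V `^ c) + 16 * Y^-1 <= 32 * (V / Y * a + Y^-1).
  have : 0 <= Y^-1 by rewrite invr_ge0 ltW.
  by rewrite -(mulrA 2) aE; lra.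
have h2 : 1 + (2 * Y `^ (- c) + v `^ (- c)) * (w * w `^ c) <= 3 * (1 + w * b).
  have : (2 * Y `^ (- c) + v `^ (- c)) * (w * w `^ c) <= (3 * v `^ (- c)) * (w * w `^ c).
    by rewrite ler_wpM2r //; lra.
  by rewrite -(mulrA 3) bE; have : 0 <= w * b by [rewrite mulr_ge0 // ltW]; lra.
have h3 : 2 * M * Y / v <= 4 * M * (Y / V).
  have : Y / v <= 2 * (Y / V).
    rewrite ler_pdivrMr // mulrA mulrAC ler_pdivlMr //; nra.
  move=> /(ler_wpM2l (mulr_ge0 (ler0n R 2) M0)).
  by rewrite !mulrA (_ : 2 * M * 2 = 4 * M) //; ring.
have hab : a * b <= 2 * w / V * rho.
  rewrite /b -mulr_powRB1 ?(ltW x0) // mulrCA; apply: ler_pM => //.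
  - exact: ltW.
  - by rewrite mulr_ge0 ?powR_ge0.
  rewrite /a -powRM ?(ltW x0) ?divr_ge0 ?(ltW V0) ?(ltW Y0) //.
  apply: ge0_ler_powR => //; rewrite ?nnegrE.
  - by apply: mulr_ge0; rewrite divr_ge0 // ltW.
  - by rewrite divr_ge0 ?(ltW Y0) // mulr_ge0 // ltW.
  rewrite mulf_div [_ / (Y * v)](_ : _ = w / Y * (V / v)); last by field; rewrite !gt_eqF.
  rewrite (_ : 2 * w / Y = w / Y * 2); last by ring.
  apply: ler_wpM2l; first by rewrite divr_ge0 // ltW.
  by rewrite ler_pdivrMr.
have Vi0 : 0 <= V^-1 by rewrite invr_ge0 ltW.
have Yi0 : 0 <= Y^-1 by rewrite invr_ge0 ltW.
have q0 : 0 <= V / Y by rewrite divr_ge0 // ltW.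
have wb0 : 0 <= w * b by rewrite mulr_ge0 // ltW.
have dD0 : 0 <= 2 * Y `^ (- c) + v `^ (- c).
  by rewrite addr_ge0 ?powR_ge0 // mulr_ge0 ?powR_ge0.
have KK : 0 <= 2 * K by rewrite mulr_ge0.
apply: (@le_trans _ _ (32 * (V / Y * a + Y^-1) *
   (2 * K * (3 * (1 + w * b))) * (4 * M * (Y / V)))).
  apply: ler_pM => //.
  - apply: mulr_ge0.
      by apply: addr_ge0; apply: mulr_ge0 => //; rewrite mulr_ge0 ?powR_ge0 // mulr_ge0 ?powR_ge0.
    by apply: mulr_ge0 => //; rewrite addr_ge0 // mulr_ge0.
  - by rewrite divr_ge0 ?(ltW v0) // mulr_ge0 ?(ltW Y0) // mulr_ge0.
  apply: ler_pM => //.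
  - by apply: addr_ge0; apply: mulr_ge0 => //; rewrite mulr_ge0 ?powR_ge0 // mulr_ge0 ?powR_ge0.
  - by apply: mulr_ge0 => //; rewrite addr_ge0 // mulr_ge0.
  by rewrite ler_wpM2l.
have -> : 32 * (V / Y * a + Y^-1) * (2 * K * (3 * (1 + w * b))) * (4 * M * (Y / V)) =
  768 * K * M * ((a + V^-1) * (1 + w * b)) by field; rewrite !gt_eqF.
apply: ler_wpM2l; first exact: (mulr_ge0 (mulr_ge0 (ler0n R 768) K0) M0).
have -> : (a + V^-1) * (1 + w * b) = a + (V^-1 + w * b * V^-1 + w * (a * b)) by ring.
rewrite lerD2l.
have h4 : w * b * V^-1 <= w * V^-1 by rewrite ler_wpM2r // ler_piMr // ltW.
have h5 : w * (a * b) <= w * (2 * w / V * rho) by rewrite ler_wpM2l // ltW.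
have -> : (1 + w + 2 * w ^+ 2 * rho) / V = V^-1 + w * V^-1 + w * (2 * w / V * rho) by ring.
lra.
Qed.

Let K : R := 512 * mertens_bound.

Let M0 : 0 <= (mertens_bound : R) := le_trans ler01 mertens_bound_ge1.

Let K0 : 0 <= K. Proof. exact: mulr_ge0 (ler0n R 512) M0. Qed.

Let A : R := 768 * K * mertens_bound.

Let A0 : 0 <= A.
Proof. exact: (mulr_ge0 (mulr_ge0 (ler0n R 768) K0) M0). Qed.

Lemma log_primes_empty (v : R) : log_primes v v = [::].
Proof.
apply/eqP; rewrite -size_eq0 -leqn0 leqNgt -has_predT; apply/hasPn => p.
by rewrite mem_log_primes => /and3P[_ /lt_le_trans h /h]; rewrite ltxx.
Qed.

Lemma concentration_iter (w Y u : R) i : 1 <= w -> w <= Y -> expR (- (w / 2)) = Y^-1 ->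
  w <= 2 * (Y / 2 ^+ i) ->
  subset_sum f (log_primes 0 w ++ log_primes (Num.max w (Y / 2 ^+ i)) Y)
    (window u (2 * Y `^ (- c))) <=
  2 * K * (1 + 2 * Y `^ (- c) * (w * w `^ c)) +
  A * \sum_(j < i) ((2^-1 `^ (c - 1)) ^+ j +
     (1 + w + 2 * w ^+ 2 * (2 * w / Y) `^ (c - 1)) * (2 ^+ j / Y)).
Proof.
move=> w1 wY wE.
have w0 : 0 < w by lra.
have Y0 : 0 < Y by lra.
have d0 : 0 <= 2 * Y `^ (- c) by rewrite mulr_ge0 ?powR_ge0.
have p2 n : 0 < 2 ^+ n :> R by rewrite exprn_gt0.
elim: i => [_|i IH wi].
  rewrite expr0 divr1 big_ord0 mulr0 addr0 max_r // log_primes_empty cats0.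
  exact: smooth_concentration.
set V := Y / 2 ^+ i in IH.
have V0 : 0 < V by rewrite divr_gt0.
have VE : Y / 2 ^+ i.+1 = V / 2 by rewrite /V exprS invfM mulrA mulrAC.
rewrite VE in wi *.
have wV : w <= V by lra.
set v := Num.max w (V / 2).
have wv : w <= v by rewrite /v le_max lexx.
have vV : v <= V by rewrite /v ge_max wV; lra.
have Vv : V <= 2 * v by have : V / 2 <= v by [rewrite /v le_max lexx orbT]; lra.
have VY : V <= Y by rewrite /V ler_pdivrMr // ler_peMr ?(ltW Y0) // exprn_ege1 // ler1n.
apply: le_trans (concentration_block c1 fp u w1 wv vV VY d0) _.
have -> : log_primes V Y = log_primes (Num.max w V) Y by rewrite max_r.
have {}IH : _ := IH _; apply: le_trans (lerD (IH _) (block_term_le K0 M0 w1 wv vV Vv VY wE)) _.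
  by rewrite -/V; lra.
rewrite [X in _ <= _ + A * X]big_ord_recr [X in _ <= _ + X]mulrDr [leRHS]addrA lerD2l.
apply: ler_wpM2l; first exact: A0.
have -> : V / Y = 2^-1 ^+ i by rewrite /V mulrAC divff ?gt_eqF // mul1r exprVn.
have -> : V^-1 = 2 ^+ i / Y by rewrite /V invf_div.
have -> : (2^-1 ^+ i) `^ (c - 1) = (2^-1 `^ (c - 1)) ^+ i :> R.
  have h2 : 0 <= 2^-1 :> R by rewrite invr_ge0 ler0n.
  by rewrite -(powR_mulrn i h2) -(powR_mulrn i (powR_ge0 _ _)) powRAC.
by rewrite lexx.
Qed.

Lemma le_min_factor (x eps : R) : x <= ln (1 / eps) -> (1 < c -> x <= c / (c - 1)) ->
  x <= min_factor c eps.
Proof.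
move=> h1 h2; rewrite /min_factor; case: eqVneq => // cn1.
by rewrite le_min h1 andbT h2 // lt_neqAle eq_sym cn1.
Qed.

Lemma sum_pow2_le n : \sum_(j < n) 2 ^+ j <= 2 ^+ n :> R.
Proof.
elim: n => [|n IH]; first by rewrite big_ord0.
by rewrite (sum_ord_recr (fun j => 2 ^+ j)) exprS; lra.
Qed.

Lemma sum_geometric_le (r : R) n : 0 <= r -> r < 1 -> \sum_(j < n) r ^+ j <= (1 - r)^-1.
Proof.
move=> r0 r1; rewrite -[leRHS]mul1r ler_pdivlMr ?subr_gt0 //.
have := subrX1 r n; have := exprn_ge0 n r0.
by set S := \sum_(j < n) _; lra.
Qed.

Lemma ln2_ge : 1 / 2 <= ln 2 :> R.
Proof. by apply: le_trans (ln_ge_1subV _); lra. Qed.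

(** With E = 2^(c-1) the left side is E / (E - 1), and E >= 1 + (c - 1)/2 because ln 2 >= 1/2. *)
Lemma geometric_ratio_le : 1 < c -> (1 - 2^-1 `^ (c - 1))^-1 <= 2 * (c / (c - 1)).
Proof.
move=> cgt1; have cm0 : 0 < c - 1 by rewrite subr_gt0.
have l2 := ln2_ge.
have -> : 2^-1 `^ (c - 1) = (expR ((c - 1) * ln 2))^-1.
  by rewrite /powR gt_eqF // lnV ?posrE // -expRN mulrN.
set x := (c - 1) * ln 2.
have xh : (c - 1) / 2 <= x by rewrite /x; nra.
have e1 := expR_ge1Dx x.
set E := expR x in e1 *.
have E1 : 1 < E by lra.
have -> : (1 - E^-1)^-1 = E / (E - 1).
  by field; rewrite !gt_eqF //; lra.
rewrite ler_pdivrMr ?subr_gt0 // mulrA mulrAC ler_pdivlMr //.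
nra.
Qed.

Lemma concentration_primes (Y u : R) : 16 ^+ 4 <= Y ->
  subset_sum f (log_primes 0 Y) (window u (2 * Y `^ (- c))) <=
  (3 * K + 23 * A) * min_factor c (Y `^ (- c)).
Proof.
move=> Ybig; have Y4 : 4 <= Y by lra.
have Y1 : 1 < Y by lra.
have Y0 : 0 < Y by lra.
(* Origin of 16^4: z = Y^(1/4) >= 16 and ln Y <= 4 z, so w = 2 ln Y <= 8 z and 4 w^2 <= 256 z^2 <=
   z^4 = Y. *)
pose z := expR (ln Y / 4).
have zE : z ^+ 4 = Y by rewrite /z -expRM_natl mulrC divfK ?lnK ?posrE.
have z0 : 0 < z by exact: expR_gt0.
have z16 : 16 <= z.
  rewrite leNgt; apply/negP => zl; move: Ybig; rewrite -zE leNgt => /negP; apply.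
  by rewrite ltrXn2r // ltW.
have lz : ln Y <= 4 * z by have := expR_ge1Dx (ln Y / 4); rewrite -/z; lra.
have lnY1 : 1 <= ln Y.
  have l2 := ln2_ge; apply: (@le_trans _ _ (ln (2 ^+ 2))); first by rewrite lnXn // mulr2n; lra.
  by rewrite ler_ln ?posrE ?exprn_gt0 //; lra.
pose w := 2 * ln Y.
have w1 : 1 <= w by rewrite /w; lra.
have w0 : 0 < w by lra.
have w2Y : 4 * w ^+ 2 <= Y.
  have h : w <= 8 * z by rewrite /w; lra.
  apply: (@le_trans _ _ (256 * z ^+ 2)).
    rewrite (_ : 256 * z ^+ 2 = 4 * (8 * z) ^+ 2); last by ring.
    apply: ler_wpM2l; first exact: ler0n.
    by apply: lerXn2r => //; rewrite nnegrE; lra.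
  rewrite -zE (_ : z ^+ 4 = z ^+ 2 * z ^+ 2); last by ring.
  rewrite ler_wpM2r ?sqr_ge0 // (_ : 256 = 16 ^+ 2 :> R); last by ring.
  by apply: lerXn2r => //; rewrite nnegrE; lra.
have w2Y' : 2 * w <= Y by apply: le_trans w2Y; nra.
have wY : w <= Y by lra.
have wE : expR (- (w / 2)) = Y^-1.
  by rewrite /w mulrC mulKf ?gt_eqF // expRN lnK ?posrE.
set L := min_factor c _.
have lnL : ln (1 / Y `^ (- c)) = c * ln Y.
  by rewrite powRN mul1r invrK ln_powR.
have cl : ln Y <= c * ln Y by rewrite ler_peMl // (le_trans ler01).
have L1 : 1 <= L.
  apply: le_min_factor => [|cgt1]; first by rewrite lnL (le_trans lnY1).
  by rewrite ler_pdivlMr ?subr_gt0 // mul1r gerBl.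
set rho := (2 * w / Y) `^ (c - 1).
have rho0 : 0 <= rho by exact: powR_ge0.
(* The logarithmic bound uses rho <= 1. For c > 1, 2 w <= Y^(1/2) gives rho <= exp(-t) with t = (c -
   1) ln(Y) / 2, and t exp(-t) <= 1 yields w rho <= 4 / (c - 1). *)
have wrho : w * rho <= 4 * L.
  rewrite -ler_pdivrMl // mulrC; apply: le_min_factor => [|cgt1].
    rewrite lnL ler_pdivrMr //; have rho1 : rho <= 1.
      have q0 : 0 < 2 * w / Y by rewrite divr_gt0 // mulr_gt0.
      have q1 : 2 * w / Y <= 1 by rewrite ler_pdivrMr // mul1r.
      by rewrite -[leRHS](powRr0 (2 * w / Y)) /rho ger_powR ?q0 // subr_ge0.
    by apply: (@le_trans _ _ w); [rewrite ler_piMr // ltW | rewrite /w; lra].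
  have cm0 : 0 < c - 1 by rewrite subr_gt0.
  have hr : rho <= expR (- ((c - 1) * ln Y / 2)).
    have -> : expR (- ((c - 1) * ln Y / 2)) = (expR (- (ln Y / 2))) `^ (c - 1).
      by rewrite -expRM; congr expR; ring.
    apply: ge0_ler_powR; rewrite ?nnegrE ?expR_ge0 ?(ltW cm0) //.
      by rewrite divr_ge0 ?(ltW Y0) // mulr_ge0 // ltW.
    have hs : (expR (ln Y / 2)) ^+ 2 = Y by rewrite -expRM_natl mulrC divfK ?lnK ?posrE.
    set sq := expR (ln Y / 2) in hs *.
    have sq0 : 0 < sq by exact: expR_gt0.
    have wsq : 2 * w <= sq.
      rewrite -ler_sqr ?nnegrE ?(ltW sq0) //; last by rewrite mulr_ge0 // ltW.
      by rewrite hs exprMn (_ : 2 ^+ 2 = 4 :> R) //; ring.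
    by rewrite expRN ler_pdivrMr // -/sq -[X in _ <= _ * X]hs expr2 mulKf ?gt_eqF.
  set t := (c - 1) * ln Y / 2 in hr.
  have t0 : 0 < t by rewrite divr_gt0 // mulr_gt0 //; lra.
  have ht : t * expR (- t) <= 1.
    rewrite expRN ler_pdivrMr ?expR_gt0 // mul1r; have := expR_ge1Dx t; lra.
  rewrite ler_pdivrMr // [leRHS]mulrAC ler_pdivlMr //.
  have : w * rho * (c - 1) <= 4 * (t * expR (- t)).
    rewrite (_ : 4 * _ = w * expR (- t) * (c - 1)); last by rewrite /w /t; field.
    by rewrite ler_wpM2r ?(ltW cm0) // ler_wpM2l // ltW.
  have := c1; lra.
have exn : exists n : nat, Y / 2 ^+ n <= w.
  exists (Num.truncn Y).+1; apply: le_trans w1.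
  rewrite ler_pdivrMr ?exprn_gt0 // mul1r; apply: le_trans (ltW (truncnS_gt Y)) _.
  by rewrite -natrX ler_nat ltnW // ltn_expl.
case: (ex_minnP exn) => [[|n] nP nmin].
  by exfalso; move: nP; rewrite expr0 divr1; lra.
have nlt : w < Y / 2 ^+ n.
  by rewrite ltNge; apply/negP => /nmin; rewrite ltnn.
have p2 : 0 < 2 ^+ n :> R by rewrite exprn_gt0.
have wn : w <= 2 * (Y / 2 ^+ n.+1).
  rewrite exprS (_ : 2 * _ = Y / 2 ^+ n) ?(ltW nlt) //.
  by field; rewrite gt_eqF.
have := concentration_iter u w1 wY wE wn.
rewrite max_l // => H.
rewrite (subset_sum_perm _ _ (log_primes_cat (ltW w0) wY)).
apply: le_trans H _.
rewrite big_split /= -mulr_sumr -mulr_suml -/rho.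
set Sr := \sum_(i < n.+1) _ ^+ i; set S2 := \sum_(i < n.+1) 2 ^+ i.
have hS2 : S2 / Y <= 2 / w.
  rewrite ler_pdivrMr // mulrAC ler_pdivlMr //.
  apply: le_trans (ler_wpM2r (ltW w0) (sum_pow2_le n.+1)) _.
  by rewrite exprS -mulrA ler_wpM2l // mulrC -ler_pdivlMr // ltW.
have r0 : 0 <= 2^-1 `^ (c - 1) by exact: powR_ge0.
have r1 : 2^-1 `^ (c - 1) <= 1.
  have h2 : 0 < 2^-1 :> R by rewrite invr_gt0.
  have h3 : 2^-1 <= 1 :> R by rewrite invf_le1 // ler1n.
  by rewrite -[leRHS](powRr0 2^-1) ger_powR ?h2 // subr_ge0.
(* Source of the minimum: Sr is at most its number of terms, n + 1 <= 2 ln Y + 1, and for c > 1 at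
   most the full geometric series. *)
have hSr : Sr <= 3 * L.
  rewrite -ler_pdivrMl // mulrC; apply: le_min_factor => [|cgt1].
    rewrite lnL ler_pdivrMr //.
    have h : Sr <= n.+1%:R.
      rewrite /Sr -[n.+1 in leRHS]card_ord -sum1_card natr_sum.
      by apply: ler_sum => j _; rewrite exprn_ile1.
    have h2 : n%:R * ln 2 <= ln Y.
      rewrite mulr_natl -lnXn // ler_ln ?posrE //.
      apply: le_trans (_ : Y / w <= Y); last by rewrite ler_pdivrMr // ler_peMr // ltW.
      by rewrite ler_pdivlMr // mulrC -ler_pdivlMr // ltW.
    have h3 : n%:R * (1 / 2) <= n%:R * ln 2 :> R by rewrite ler_wpM2l // ln2_ge.
    by move: h; rewrite -natr1; lra.
  rewrite ler_pdivrMr //; apply: le_trans (sum_geometric_le n.+1 r0 _) _.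
    rewrite -[ltRHS]expR0 /powR gt_eqF // ltr_expR pmulr_rlt0 ?subr_gt0 // lnV ?posrE //.
    by have := ln2_ge; lra.
  apply: le_trans (geometric_ratio_le cgt1) _.
  have : 0 <= c / (c - 1) by rewrite divr_ge0 // subr_ge0.
  lra.
have h0 : 2 * Y `^ (- c) * (w * w `^ c) <= 1 / 2.
  have x0 : 0 < w / Y by rewrite divr_gt0.
  have x1 : w / Y <= 1 by rewrite ler_pdivrMr // mul1r.
  have h : (w / Y) `^ c <= w / Y by apply: ge1r_powR => //; rewrite x0.
  rewrite (_ : 2 * _ * _ = 2 * w * (w `^ c * Y `^ (- c))); last by ring.
  rewrite -powR_div ?(ltW w0) //.
  apply: (@le_trans _ _ (2 * w * (w / Y))); first by rewrite ler_wpM2l // mulr_ge0 // ltW.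
  rewrite mulrA ler_pdivrMr //; move: w2Y; rewrite expr2; lra.
have Z0 : 0 <= 1 + w + 2 * w ^+ 2 * rho.
  by rewrite addr_ge0 ?addr_ge0 ?(ltW w0) // mulr_ge0 // mulr_ge0 // sqr_ge0.
have hZ : (1 + w + 2 * w ^+ 2 * rho) * (S2 / Y) <= 4 + 4 * (w * rho).
  apply: le_trans (ler_wpM2l Z0 hS2) _.
  rewrite (_ : _ * (2 / w) = 2 / w + 2 + 4 * (w * rho)); last first.
    by field; rewrite gt_eqF.
  rewrite lerD2r; have : 2 / w <= 2 by rewrite ler_pdivrMr // ler_peMr.
  lra.
(* 23 = 3 + 4 + 4 * 4, from [hSr], [hZ] and [wrho], using L >= 1. *)
apply: (@le_trans _ _ (3 * K + A * (23 * L))).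
  apply: lerD.
    rewrite (_ : 3 * K = 2 * K * (3 / 2)); last by field.
    apply: ler_wpM2l; last by lra.
    exact: mulr_ge0 (ler0n R 2) K0.
  by apply: ler_wpM2l; [exact: A0 | lra].
rewrite [leRHS]mulrDl; apply: lerD; last by rewrite mulrCA mulrA.
rewrite ler_peMr //; exact: mulr_ge0 (ler0n R 3) K0.
Qed.

End Concentration.

(** * Density of continuity points *)

Section ContinuityPoints.
Context {R : realType}.

(** Convergence to F is known at continuity points only, so window ends must be moved to such
    points. Were there none, (a, b) would be a countable set of jumps, against its positive
    measure. *)
Lemma nondecreasing_continuity_point (F : R -> R) (a b : R) :
  nondecreasing F -> right_continuous F -> a < b ->
  exists2 u, a < u < b & {for u, continuous F}.
Proof.
move=> ndF rcF ab; apply: contrapT => H.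
have D : `]a, b[ `<=` [set x | x \in `]a, b[%R /\ discontinuity F x].
  move=> u uab; split; first by [].
  have lc : cvg (F x @[x --> u^'-]).
    apply: nondecreasing_at_left_is_cvgr.
      by near=> x => y z _ _; exact: ndF.
    near=> x; exists (F u) => _ [y yxu <-]; apply: ndF.
    by move: yxu; rewrite /= in_itv /= => /andP[_ /ltW].
  have rc : F x @[x --> u^'+] --> F u := rcF u.
  have rl : lim (F x @[x --> u^'+]) = F u by exact: cvg_lim rc.
  split=> //; first by apply/cvg_ex; exists (F u).
  rewrite rl; apply/eqP => E; apply: H; exists u; first by move: uab; rewrite /= in_itv.
  apply/left_right_continuousP; split=> //.
  by rewrite -E.
have : lebesgue_measure (`]a, b[%classic : set R) = 0%E.
  apply: countable_lebesgue_measure0.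
  apply: sub_countable (@discontinuity_countable R a b F _).
    exact: subset_card_le.
  by move=> x y _ _; exact: ndF.
rewrite lebesgue_measure_itv /= lte_fin ab -EFinB => /eqP.
by rewrite eqe subr_eq0 gt_eqF.
Unshelve. all: by end_near. Qed.

End ContinuityPoints.

(** * From counting functions to logarithmic sums *)

Section LogDensity.
Context {R : realType}.
Implicit Types (a : nat -> R) (k : R) (N : nat).

Let partial a N := \sum_(1 <= n < N.+1) a n.

(* Partial summation: sum a(n)/n - A(N)/N moves by A(N)/(N(N+1)). *)
Lemma log_sum_step a N : (0 < N)%N ->
  \sum_(1 <= n < N.+2) n%:R^-1 * a n - partial a N.+1 / N.+1%:R =
  \sum_(1 <= n < N.+1) n%:R^-1 * a n - partial a N / N%:R +
  partial a N * (N%:R^-1 - N.+1%:R^-1).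
Proof.
move=> N0; rewrite big_nat_recr //= /partial [in X in _ - X / _]big_nat_recr //=.
by ring.
Qed.

(** Each increment is at most k / (N + 1), which is at most k (ln(N + 1) - ln N). *)
Lemma log_sum_upper a k N0 : 0 <= k -> (0 < N0)%N ->
  (forall N, (N0 <= N)%N -> partial a N <= k * N%:R) ->
  exists C, forall N, (N0 <= N)%N ->
    \sum_(1 <= n < N.+1) n%:R^-1 * a n <= k * ln N%:R + C.
Proof.
move=> k0 N00 H; pose X N := \sum_(1 <= n < N.+1) n%:R^-1 * a n - partial a N / N%:R.
exists (X N0 - k * ln N0%:R + k) => N NN.
suff : X N <= X N0 + k * (ln N%:R - ln N0%:R).
  have := H N NN; rewrite -ler_pdivrMr ?ltr0n ?(leq_trans N00) // /X.
  by move: (partial a N / N%:R) => y; lra.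
rewrite -(subnKC NN); elim: (N - N0)%N => [|j IH]; first by rewrite addn0 subrr mulr0 addr0.
rewrite addnS; set M := (N0 + j)%N in IH *.
have M0 : (0 < M)%N by rewrite /M ltn_addr.
rewrite {1}/X log_sum_step // -/(X M).
have MR : 0 < M%:R :> R by rewrite ltr0n.
have h : partial a M * (M%:R^-1 - M.+1%:R^-1) <= k * (ln M.+1%:R - ln M%:R).
  have -> : M%:R^-1 - M.+1%:R^-1 = (M%:R * M.+1%:R)^-1 :> R.
    by rewrite -natr1; field; rewrite !gt_eqF // addr_gt0.
  rewrite ler_pdivrMr ?mulr_gt0 ?ltr0n //.
  apply: le_trans (H M (leq_addr _ _)) _.
  rewrite -mulrA ler_wpM2l // mulrCA ler_peMr ?(ltW MR) //.
  rewrite -ler_pdivrMr ?ltr0n // div1r; exact: ln_succ_sub_ge.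
by move: IH h; move: (ln M.+1%:R) (partial a M * _) => y z; lra.
Qed.

(** Here k / (N + 1) falls short of the increment of k ln N, by at most k / N - k / (N + 1); the
    induction carries this telescoping correction. *)
Lemma log_sum_lower a k N0 : 0 <= k -> (0 < N0)%N -> (forall n, 0 <= a n) ->
  (forall N, (N0 <= N)%N -> k * N%:R <= partial a N) ->
  exists C, forall N, (N0 <= N)%N ->
    k * ln N%:R + C <= \sum_(1 <= n < N.+1) n%:R^-1 * a n.
Proof.
move=> k0 N00 a0 H; pose X N := \sum_(1 <= n < N.+1) n%:R^-1 * a n - partial a N / N%:R.
exists (X N0 - k * ln N0%:R - k / N0%:R) => N NN.
have NR : 0 < N%:R :> R by rewrite ltr0n (leq_trans N00).
suff : X N0 + k * (ln N%:R - ln N0%:R) + k / N%:R - k / N0%:R <= X N.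
  have : 0 <= k / N%:R by rewrite divr_ge0 // ltW.
  have : 0 <= partial a N / N%:R.
    by rewrite divr_ge0 ?(ltW NR) // sumr_ge0.
  by rewrite /X; move: (partial a N / N%:R) (k / N%:R) => y z; lra.
rewrite -(subnKC NN); elim: (N - N0)%N => [|j IH].
  by rewrite addn0 subrr mulr0 addr0 addrK.
rewrite addnS; set M := (N0 + j)%N in IH *.
have M0 : (0 < M)%N by rewrite /M ltn_addr.
rewrite [leRHS]/X log_sum_step // -/(X M).
have MR : 0 < M%:R :> R by rewrite ltr0n.
have h : k * (ln M.+1%:R - ln M%:R) - k / M%:R + k / M.+1%:R <= partial a M * (M%:R^-1 - M.+1%:R^-1).
  have E : M%:R^-1 - M.+1%:R^-1 = (M%:R * M.+1%:R)^-1 :> R.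
    by rewrite -natr1; field; rewrite !gt_eqF // addr_gt0.
  apply: (@le_trans _ _ (k * M%:R * (M%:R^-1 - M.+1%:R^-1))); last first.
    by rewrite ler_wpM2r ?H ?leq_addr // E invr_ge0 mulr_ge0.
  have hl := @ln_succ_sub_le R M M0.
  have -> : k * M%:R * (M%:R^-1 - M.+1%:R^-1) = k * M.+1%:R^-1.
    by rewrite -natr1; field; rewrite !gt_eqF // addr_gt0.
  have : k * (ln M.+1%:R - ln M%:R) <= k * M%:R^-1 by rewrite ler_wpM2l.
  by move: (M.+1%:R^-1) (M%:R^-1) (ln M.+1%:R) => p q l; lra.
by move: IH h; move: (ln M.+1%:R) (partial a M * _) (k / M.+1%:R) => y z t; lra.
Qed.

Lemma ln_coef_le (x y C : R) N0 :
  (forall N, (N0 <= N)%N -> x * ln N%:R <= y * ln N%:R + C) -> x <= y.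
Proof.
move=> H; rewrite leNgt; apply/negP => yx.
pose t := `|C| / (x - y) + 1.
pose N := (maxn N0 (Num.truncn (expR t)).+1).
have tN : t <= ln N%:R.
  rewrite -[leLHS]expRK ler_ln ?posrE ?expR_gt0 ?ltr0n ?leq_max ?orbT //.
  by apply: le_trans (ltW (truncnS_gt _)) _; rewrite ler_nat leq_max leqnn orbT.
have xy0 : 0 < x - y by rewrite subr_gt0.
have := H N (leq_maxl _ _).
have : (x - y) * t <= (x - y) * ln N%:R by rewrite ler_wpM2l // ltW.
rewrite /t mulrDr mulr1 mulrCA divff ?gt_eqF // mulr1.
have := ler_norm C; lra.
Qed.

Definition in_window (u1 u2 x : R) : R := ((u1 < x) && (x <= u2))%:R.

Lemma count_window (f : nat -> R) (u1 u2 : R) N : u1 <= u2 ->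
  partial (fun n => in_window u1 u2 (f n)) N =
  (count (fun n => f n <= u2) (index_iota 1 N.+1))%:R -
  (count (fun n => f n <= u1) (index_iota 1 N.+1))%:R.
Proof.
move=> u12; rewrite /partial -!sum1_count !natr_sum !(big_mkcond (fun n => f n <= _)) /=.
rewrite -sumrB; apply: eq_bigr => n _; rewrite /in_window.
have [h1|h1] := leP (f n) u1; first by rewrite (le_trans h1 u12) subrr.
by case: leP => _; rewrite subr0.
Qed.

Lemma limit_distribution_window (f : nat -> R) (F : cumulativeBounded (0 : R) (1 : R))
    (u1 u2 : R) : is_limit_distribution f F -> u1 <= u2 ->
  {for u1, continuous F} -> {for u2, continuous F} ->
  (fun N => partial (fun n => in_window u1 u2 (f n)) N / N%:R) @ \oo --> F u2 - F u1.
Proof.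
move=> limF u12 c1 c2.
have h : forall u : R, {for u, continuous F} ->
    (fun N => empirical_cdf f u N%:R) @ \oo --> F u.
  by move=> u hu; exact: (cvg_comp _ _ (@cvgr_idn R) (limF u hu)).
rewrite (_ : (fun N => _) =
  (fun N => empirical_cdf f u2 N%:R) \- (fun N => empirical_cdf f u1 N%:R)).
  by apply: cvgB; exact: h.
by apply/funext => N; rewrite /empirical_cdf /= !natrK count_window // mulrBl.
Qed.

End LogDensity.

(** * Values of f on rough squarefree numbers *)

Lemma additive_sqfree (R : realType) (f : nat -> R) d :
  additive_function f -> sqfree d -> f d = \sum_(p <- primes d) f p.
Proof.
move=> addf; elim/ltn_ind: d => d IH sd; have d0 := sqfree_gt0 sd.
have [->|d1] := eqVneq d 1%N.
  by rewrite big_nil; have := addf 1%N 1%N isT isT isT; lra.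
have pp : prime (pdiv d) by rewrite pdiv_prime //; move: d0 d1; case: d {IH sd} => [|[]].
move: pp (pdiv_dvd d); move: (pdiv d) => p pp /dvdnP[k dE].
have k0 : (0 < k)%N by move: d0; rewrite dE muln_gt0 => /andP[].
have [pk|pk] := boolP (p %| k)%N; first by rewrite dE mulnC sqfreeM_dvd in sd.
have sk : sqfree k by move: sd; rewrite dE mulnC sqfreeMl.
have kd : (k < d)%N by rewrite dE ltn_Pmulr ?prime_gt1.
rewrite dE mulnC (perm_big _ (perm_primesM pp k0 pk)) /= big_cons -IH //.
by apply: addf => //; rewrite ?prime_coprime // prime_gt0.
Qed.

Section RoughNumbers.
Context {R : realType}.
Variables (c : R) (f : nat -> R).
Hypothesis c1 : 1 <= c.
Hypothesis addf : additive_function f.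
Hypothesis fp : forall p : nat, prime p -> f p = ln (p%:R : R) `^ (- c).

Let c0 : 0 <= c := le_trans ler01 c1.

Lemma half_powR_le (v : R) : 0 < v -> (2 * v) `^ (- c) <= v `^ (- c) / 2.
Proof.
move=> v0; rewrite powRM ?(ltW v0) // mulrC ler_wpM2l ?powR_ge0 // powRN.
by rewrite lef_pV2 ?posrE ?powR_gt0 // le1r_powR // ler1n.
Qed.

Lemma sum_value_dyadic (v : R) : 0 < v ->
  \sum_(p <- log_primes v (2 * v)) p%:R^-1 * f p <= 32 * v `^ (- c).
Proof.
move=> v0.
apply: (@le_trans _ _ (\sum_(p <- log_primes v (2 * v)) p%:R^-1 * v `^ (- c))).
  rewrite !big_seq; apply: ler_sum => p plog; rewrite ler_wpM2l ?invr_ge0 //.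
  by have /andP[] := value_log_primes_le c1 fp v0 plog.
rewrite -mulr_suml ler_wpM2r ?powR_ge0 //.
have := @sum_log_primes_window R v (2 * v) xpredT 1 (ltW v0) ler01.
have : expR (- (v / 2)) <= 1 by rewrite expR_le1 oppr_le0 divr_ge0 // ltW.
move=> e1 /(_ _)/le_trans; apply; last by lra.
move=> p q; rewrite !mem_log_primes => /and3P[_ vp _] /and3P[_ _ qv] _ _.
by apply: le_trans qv _; lra.
Qed.

(** The subtracted term makes the dyadic blocks telescope: 32 w^(-c) <= 64 (w^(-c) - (2 w)^(-c)), as
    c >= 1. *)
Lemma sum_value_tail (v : R) n : 0 < v ->
  \sum_(p <- log_primes v (2 ^+ n * v)) p%:R^-1 * f p <=
  64 * (v `^ (- c) - (2 ^+ n * v) `^ (- c)).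
Proof.
move=> v0; elim: n => [|n IH].
  by rewrite expr0 mul1r log_primes_empty big_nil subrr mulr0.
set w := 2 ^+ n * v in IH *.
have w0 : 0 < w by rewrite mulr_gt0 // exprn_gt0.
have -> : 2 ^+ n.+1 * v = 2 * w by rewrite exprS mulrA.
have vw : v <= w by rewrite ler_peMl ?(ltW v0) // exprn_ege1 // ler1n.
have ww : w <= 2 * w by lra.
rewrite (perm_big _ (log_primes_cat vw ww)) big_cat /=.
have := sum_value_dyadic w0; have := half_powR_le w0; lra.
Qed.

(** First moment for Markov's inequality: f(b) is expanded over the primes p | b, and with b = p m
    each p > exp(V) contributes at most f(p)/p times the full sum. *)
Lemma rough_markov (V : R) N : 0 < V ->
  \sum_(1 <= b < N.+1 | rough_sqfree (log_primes 0 V) b) b%:R^-1 * f b <=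
  64 * V `^ (- c) * sqfree_sum (log_primes 0 V) N.
Proof.
move=> V0; set s := log_primes 0 V.
(* W is V times a power of 2, to fit [sum_value_tail], and exceeds ln p for every prime p dividing
   some b <= N, because ln p < p <= N <= W. *)
pose n := Num.truncn (N%:R / V); pose W := 2 ^+ n.+1 * V.
have NW : N%:R <= W.
  rewrite -ler_pdivrMr //; apply: le_trans (ltW (truncnS_gt _)) _.
  by rewrite -natrX ler_nat ltnW // ltn_expl.
have fp0 p : p \in log_primes V W -> 0 <= f p.
  by move=> /(value_log_primes_le c1 fp V0) /andP[].
have D0 : 0 <= sqfree_sum s N :> R by apply: sumr_ge0 => i _; rewrite invr_ge0.
have -> : \sum_(1 <= b < N.+1 | rough_sqfree s b) b%:R^-1 * f b =
   \sum_(p <- log_primes V W) f p *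
     \sum_(1 <= b < N.+1 | rough_sqfree s b && (p %| b)%N) b%:R^-1.
  transitivity (\sum_(1 <= b < N.+1 | rough_sqfree s b)
      \sum_(p <- log_primes V W | (p %| b)%N) b%:R^-1 * f p).
    rewrite big_nat_cond [RHS]big_nat_cond; apply: eq_bigr => b /andP[/andP[b1 bN] /andP[sb /allP rb]].
    rewrite (additive_sqfree addf sb) mulr_sumr -[RHS]big_filter; apply: perm_big.
    apply: uniq_perm; rewrite ?primes_uniq ?filter_uniq ?iota_uniq // => p.
    rewrite mem_primes mem_filter mem_log_primes b1 /= [RHS]andbC -andbA.
    case: (boolP (prime p)) => //= pp; apply/idP/idP => [pb|/andP[]//].
    rewrite pb andbT; have lp0 := @ln_prime_gt0 R p pp.
    have ps : p \notin s by apply/negP => /rb; rewrite pb.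
    move: ps; rewrite mem_log_primes pp lp0 /= -ltNge => -> /=.
    apply: le_trans NW; apply: le_trans (ltW (ln_sublinear _)) _.
      by rewrite ltr0n prime_gt0.
    by rewrite ler_nat -ltnS (leq_ltn_trans _ bN) // dvdn_leq.
  rewrite (exchange_big_dep xpredT) //=; apply: eq_bigr => p _.
  by rewrite mulr_sumr; apply: eq_bigr => b _; rewrite mulrC.
apply: (@le_trans _ _ (\sum_(p <- log_primes V W) p%:R^-1 * f p * sqfree_sum s N)).
  rewrite big_seq [leRHS]big_seq; apply: ler_sum => p plog.
  have pp : prime p by move: plog; rewrite mem_log_primes => /andP[].
  rewrite [_^-1 * _]mulrC -mulrA ler_wpM2l ?fp0 //.
  rewrite /sqfree_sum mulr_sumr; apply: (@ler_sum_quotient _ p).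
  - exact: prime_gt0.
  - move=> m m0 pmN /andP[/andP[sd ad] _]; split.
    + by rewrite (leq_trans _ pmN) // leq_pmull // prime_gt0.
    + have [pm|pm] := boolP (p %| m)%N; first by rewrite sqfreeM_dvd in sd.
      rewrite /rough_sqfree /= -(sqfreeMl pp pm) sd /=.
      by apply: sub_all ad => q; apply: contra => qm; rewrite dvdn_mull.
    + by rewrite natrM invfM.
  - by move=> m _ /andP[].
  - by move=> j; rewrite mulr_ge0 ?invr_ge0.
rewrite -mulr_suml ler_wpM2r //; apply: le_trans (sum_value_tail _ V0) _.
rewrite ler_wpM2l // gerBl powR_ge0 //.
Qed.

Lemma rough_value_ge0 (V : R) b : 0 < V -> rough_sqfree (log_primes 0 V) b -> 0 <= f b.
Proof.
move=> V0 /andP[sb _]; rewrite (additive_sqfree addf sb) big_seq; apply: sumr_ge0 => p.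
by rewrite mem_primes => /andP[/fp -> _]; exact: powR_ge0.
Qed.

Lemma log_sum_window_ge (Y u1 u2 : R) N : 1 <= Y -> u1 < 0 -> Y `^ (- c) / 4 <= u2 ->
  (2048 * mertens_bound * Y)^-1 * ln N%:R <=
  \sum_(1 <= n < N.+1) n%:R^-1 * in_window u1 u2 (f n).
Proof.
move=> Y1 u10 u2e; set e := Y `^ (- c) / 4 in u2e.
(* With V = 512 Y, V^(-c) <= Y^(-c) / 512 = e / 128 for every c >= 1, so the mean of f is at most 64
   e / 128 = e / 2 and f(b) <= e on at least half of the mass. *)
have [k k1 kE] : exists2 k : R, 1 <= k & k = 512 by exists 512; rewrite // ler1n.
have k0 : 0 < k by lra.
pose V := k * Y.
have Y0 : 0 < Y by lra.
have V1 : 1 <= V by rewrite /V kE; lra.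
have V0 : 0 < V by lra.
have e0 : 0 < e by rewrite divr_gt0 ?powR_gt0.
pose s := log_primes 0 V.
set D := sqfree_sum s N : R.
pose G := \sum_(1 <= b < N.+1 | rough_sqfree s b && (f b <= e)) (b%:R^-1 : R).
have hV : V `^ (- c) <= e / 128.
  have kc : k `^ (- c) <= k^-1.
    by rewrite powRN lef_pV2 ?posrE ?powR_gt0 // le1r_powR.
  rewrite /e /V powRM ?(ltW Y0) ?(ltW k0) // mulrC.
  apply: le_trans (ler_wpM2l (powR_ge0 Y (- c)) kc) _.
  by rewrite kE; lra.
have hG : D <= 2 * G.
  have h : D <= G + D / 2.
    rewrite {1}/D /sqfree_sum (bigID (fun b => f b <= e)) /= lerD2l.
    apply: (@le_trans _ _ (e^-1 * (64 * V `^ (- c) * D))); last first.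
      have D0 : 0 <= D by apply: sumr_ge0 => i _; rewrite invr_ge0.
      rewrite ler_pdivrMl //; have := ler_wpM2r D0 hV; lra.
    apply: le_trans (ler_wpM2l _ (rough_markov N V0)); last by rewrite invr_ge0 ltW.
    rewrite mulr_sumr big_mkcondr /=; apply: ler_sum => b rb.
    have fb := rough_value_ge0 V0 rb.
    have bi : 0 <= b%:R^-1 :> R by rewrite invr_ge0.
    case: ifPn => [|_]; last by rewrite mulr_ge0 ?invr_ge0 ?(ltW e0) // mulr_ge0.
    by rewrite -ltNge => /ltW ef; rewrite ler_pdivlMl // mulrC ler_wpM2l.
  by lra.
have hD : ln N%:R <= 2 * (mass s * D).
  have := @harm_le_mass_sqfree R s N (log_primes_prime 0 V); apply: le_trans.
  apply: le_trans (ln_le_harm N); have [->|N0] := posnP N; first by rewrite ln1 ln0.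
  by rewrite ler_ln ?posrE ?ltr0n ?ler_nat.
have m1 := mass_le V1; rewrite -/s in m1.
have mb := @mertens_bound_ge1 R.
have D0 : 0 <= D by apply: sumr_ge0 => i _; rewrite invr_ge0.
apply: (@le_trans _ _ G).
  have mb0 : 0 < mertens_bound :> R by lra.
  have q0 : 0 < 2048 * mertens_bound * Y.
    by apply: mulr_gt0 (mulr_gt0 _ mb0) Y0; rewrite ltr0n.
  rewrite ler_pdivrMl //.
  apply: le_trans hD _; have := ler_wpM2r D0 m1.
  have : mertens_bound * V * D <= mertens_bound * V * (2 * G).
    by apply: ler_wpM2l hG; apply: mulr_ge0; lra.
  rewrite /V kE; move: (mass s * D) => x; lra.
rewrite /G big_mkcond /=; apply: ler_sum => b _.
have bi : 0 <= b%:R^-1 :> R by rewrite invr_ge0.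
case: ifPn => [/andP[rb fb]|_]; last by rewrite mulr_ge0 // ler0n.
rewrite /in_window (lt_le_trans u10 (rough_value_ge0 V0 rb)) (le_trans fb u2e).
by rewrite mulr1.
Qed.

End RoughNumbers.

(** * Increments of the limit distribution *)

Section Increments.
Context {R : realType}.
Variables (f : nat -> R) (F : cumulativeBounded (0 : R) (1 : R)).
Hypothesis addf : additive_function f.
Hypothesis limF : is_limit_distribution f F.

(** Otherwise some k strictly between the bound and the increment is eventually a lower bound for
    the frequency of the window; in the logarithmic sum its coefficient of ln N contradicts
    [log_sum_le]. *)
Lemma increment_le (s : seq nat) (B d u1 u2 : R) : uniq s -> all prime s ->
  (forall u, subset_sum f s (window u d) <= B) -> u1 <= u2 -> u2 <= u1 + d ->
  {for u1, continuous F} -> {for u2, continuous F} ->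
  F u2 - F u1 <= expR 4 * B / mass s.
Proof.
move=> us sp sB u12 u2d c1 c2; set B' := expR 4 * B / mass s.
have cv := limit_distribution_window limF u12 c1 c2.
rewrite leNgt; apply/negP => lt.
pose k := (B' + (F u2 - F u1)) / 2.
have B0 : 0 <= B by apply: le_trans (sB 0); apply: subset_sum_ge0 => x; exact: window_ge0.
have B'0 : 0 <= B'.
  by rewrite /B' divr_ge0 ?mulr_ge0 ?expR_ge0 // (le_trans ler01) // mass_ge1.
have kB : B' < k by rewrite /k; lra.
have kF : k < F u2 - F u1 by rewrite /k; lra.
have k0 : 0 <= k by lra.
have [N0 _ HN0] := cvgr_gt _ cv _ kF.
have [C HC] := @log_sum_lower R (fun n => in_window u1 u2 (f n)) k N0.+1 k0 isT
  (fun n => ler0n _ _) (fun N NN => ltac:(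
     rewrite -ler_pdivlMr ?ltr0n ?(leq_trans _ NN) //; apply: ltW;
     apply: HN0; exact: ltnW NN)).
suff : k <= B' by rewrite leNgt kB.
apply: (@ln_coef_le R k B' (B' * (1 + ln (\prod_(p <- s) p)%N%:R) - C) N0.+1) => N NN.
have := HC N NN.
have N1 : (0 < N)%N by exact: leq_trans NN.
have := @log_sum_le R f s (window u1 d) B N addf us sp (window_ge0 u1 d).
move=> /(_ _ N1) h.
have {h} := h (fun y => ltac:(
  rewrite (eq_subset_sum _ _ (h := window (u1 - y) d));
  [exact: sB | by move=> x; rewrite /window; congr (_ && _)%:R; apply/idP/idP; lra])).
rewrite -/B'.
have : \sum_(1 <= n < N.+1) n%:R^-1 * in_window u1 u2 (f n) <=
       \sum_(1 <= n < N.+1) n%:R^-1 * window u1 d (f n).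
  apply: ler_sum => n _; rewrite ler_wpM2l ?invr_ge0 // /in_window /window.
  by rewrite ler_nat; case: (u1 < f n) => //=; case: (leP (f n) u2) => // /le_trans ->.
rewrite mulrDr; lra.
Qed.

Lemma increment_ge (k u1 u2 : R) : 0 <= k -> u1 <= u2 ->
  (forall N, k * ln N%:R <= \sum_(1 <= n < N.+1) n%:R^-1 * in_window u1 u2 (f n)) ->
  {for u1, continuous F} -> {for u2, continuous F} ->
  k <= F u2 - F u1.
Proof.
move=> k0 u12 H c1 c2.
have cv := limit_distribution_window limF u12 c1 c2.
rewrite leNgt; apply/negP => lt.
have F0 : 0 <= F u2 - F u1 by rewrite subr_ge0; apply: cumulative_is_nondecreasing.
pose k' := (k + (F u2 - F u1)) / 2.
have kk : k' < k by rewrite /k'; lra.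
have kF : F u2 - F u1 < k' by rewrite /k'; lra.
have k'0 : 0 <= k' by lra.
have [N0 _ HN0] := cvgr_lt _ cv _ kF.
have [C HC] := @log_sum_upper R (fun n => in_window u1 u2 (f n)) k' N0.+1 k'0 isT
  (fun N NN => ltac:(
     rewrite -ler_pdivrMr ?ltr0n ?(leq_trans _ NN) //; apply: ltW;
     apply: HN0; exact: ltnW NN)).
suff : k <= k' by rewrite leNgt kk.
apply: (@ln_coef_le R k k' C N0.+1) => N NN.
exact: le_trans (H N) (HC N NN).
Qed.

End Increments.

(** * The concentration function *)

Section ConcentrationBounds.
Context {R : realType}.

Lemma min_factor_ge (c eps : R) : 1 <= c -> 0 < eps -> eps <= 1 / 2 ->
  1 / 2 <= min_factor c eps.
Proof.
move=> c1 e0 e1; apply: le_min_factor => // [|cgt1].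
  apply: le_trans (ln2_ge) _; rewrite ler_ln ?posrE ?divr_gt0 //.
  by rewrite ler_pdivlMr //; lra.
by rewrite ler_pdivlMr ?subr_gt0 //; lra.
Qed.

Lemma powR_scale (c eps : R) : 1 <= c -> 0 < eps -> eps <= 1 / 2 ->
  exists2 Y : R, 1 <= Y & eps = Y `^ (- c) /\ eps `^ (1 / c) = Y^-1.
Proof.
move=> c1 e0 e1; have c0 : 0 < c by lra.
exists (eps `^ (- (1 / c))); last split.
- have e2 : eps <= 1 by lra.
  rewrite powRN invf_ge1 ?powR_gt0 // -[leRHS](powRr0 eps) ger_powR ?e0 //.
  by rewrite divr_ge0 // ltW.
- by rewrite -powRrM mulrNN div1r mulVf ?gt_eqF // powRr1 // ltW.
- by rewrite powRN invrK.
Qed.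

Lemma increment_upper : exists2 C : R, 0 < C &
  forall (c : R) (f : nat -> R) (F : cumulativeBounded (0 : R) (1 : R)),
    1 <= c -> additive_function f ->
    (forall p : nat, prime p -> f p = ln (p%:R : R) `^ (- c)) ->
    is_limit_distribution f F ->
    forall eps : R, 0 < eps -> eps <= 1 / 2 -> forall u,
      F (u + eps) - F u <= C * min_factor c eps * eps `^ (1 / c).
Proof.
pose C0 : R := 3 * (512 * mertens_bound) +
  23 * (768 * (512 * mertens_bound) * mertens_bound).
have mb : 0 <= (mertens_bound : R) := le_trans ler01 mertens_bound_ge1.
have C00 : 0 <= C0.
  have k0 : 0 <= 512 * mertens_bound :> R := mulr_ge0 (ler0n R _) mb.
  apply: addr_ge0; first exact: (mulr_ge0 (ler0n R _) k0).
  exact: (mulr_ge0 (ler0n R _) (mulr_ge0 (mulr_ge0 (ler0n R _) k0) mb)).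
have e4 := expR_gt0 (4 : R).
(* For Y >= 16^4, C0 is the constant of [concentration_primes] and the factor 2 comes from mass >=
   Y/2. For smaller Y, the trivial bound exp(4) is covered by 2 * 16^4, as [min_factor] is at least
   1/2. *)
exists (expR 4 * (2 * C0 + 2 * 16 ^+ 4)); first by rewrite mulr_gt0 //; lra.
move=> c f F c1 addf fp limF eps e0 e1 u.
have [Y Y1 [epsY ->]] := powR_scale c1 e0 e1.
have Y0 : 0 < Y by lra.
have ndF := cumulative_is_nondecreasing F.
have rcF := cumulative_is_right_continuous F.
(* Moving both ends outwards by less than eps / 2 explains the windows of length 2 eps. *)
have [u1 /andP[u1a u1b] cu1] : exists2 v, u - eps / 2 < v < u & {for v, continuous F}.
  by apply: nondecreasing_continuity_point => //; lra.
have [u2 /andP[u2a u2b] cu2] : exists2 v, u + eps < v < u + 3 / 2 * eps & {for v, continuous F}.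
  by apply: nondecreasing_continuity_point => //; lra.
have u12 : u1 <= u2 by lra.
have u2d : u2 <= u1 + 2 * Y `^ (- c) by rewrite -epsY; lra.
apply: (@le_trans _ _ (F u2 - F u1)).
  by apply: lerB; apply: ndF; lra.
have L1 := min_factor_ge c1 e0 e1; set L := min_factor c eps in L1 *.
have Yi : 0 < Y^-1 by rewrite invr_gt0.
pose s := log_primes 0 Y.
have us : uniq s by exact: log_primes_uniq.
have sp : all prime s by exact: log_primes_prime.
have m0 : 0 < mass s :> R by apply: lt_le_trans (mass_ge1 s).
have LY : 0 <= L * Y^-1 by rewrite mulr_ge0 //; lra.
have [Ybig|Ysmall] := leP (16 ^+ 4) Y.
  have B u' : subset_sum f s (window u' (2 * Y `^ (- c))) <= C0 * L.
    by rewrite /L epsY; exact: concentration_primes.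
  apply: le_trans (increment_le addf limF us sp B u12 u2d cu1 cu2) _.
  rewrite -!mulrA ler_wpM2l ?(ltW e4) //.
  have hm : (mass s)^-1 <= 2 * Y^-1 :> R.
    rewrite -[2]invrK -invfM lef_pV2 ?posrE ?mulr_gt0 ?invr_gt0 // mulrC.
    exact: half_le_mass (ltW Y0).
  apply: (@le_trans _ _ (C0 * (L * (2 * Y^-1)))).
    by rewrite ler_wpM2l // ler_wpM2l //; lra.
  have : 0 <= 2 * 16 ^+ 4 * (L * Y^-1) by rewrite mulr_ge0 // mulr_ge0 // exprn_ge0.
  rewrite mulrDl; lra.
have B u' : subset_sum f s (window u' (2 * Y `^ (- c))) <= mass s.
  rewrite -[leRHS]mul1r; apply: subset_sum_le_mass => x; exact: window_le1.
apply: le_trans (increment_le addf limF us sp B u12 u2d cu1 cu2) _.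
rewrite mulfK ?gt_eqF // -!mulrA ler_peMr ?(ltW e4) //.
have h1 : 0 <= 2 * C0 * (L * Y^-1) by rewrite mulr_ge0 // mulr_ge0.
have h2 : 1 <= 16 ^+ 4 * Y^-1 by rewrite ler_pdivlMr // mul1r ltW.
have h3 : 16 ^+ 4 * Y^-1 <= 2 * 16 ^+ 4 * (L * Y^-1).
  have := ler_wpM2r (ltW Yi) L1; lra.
rewrite mulrDl; lra.
Qed.

End ConcentrationBounds.

Theorem theorem1p3 (R : realType) :
  exists C1 C2 : R, 0 < C1 /\ 0 < C2 /\
    forall (c : R) (f : nat -> R) (F : cumulativeBounded (0 : R) (1 : R)),
      1 <= c ->
      additive_function f ->
      (forall p : nat, prime p -> f p = ln (p%:R : R) `^ (- c)) ->
      is_limit_distribution f F ->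
      forall eps : R, 0 < eps -> eps <= 1 / 2 ->
        C1 * eps `^ (1 / c) <= concentration F eps /\
        concentration F eps <= C2 * min_factor c eps * eps `^ (1 / c).
Proof.
have [C2 C20 up] := @increment_upper R.
have mb0 : 0 < (mertens_bound : R) := lt_le_trans ltr01 mertens_bound_ge1.
have C10 : 0 < 2048 * (mertens_bound : R) by apply: mulr_gt0 mb0; rewrite ltr0n.
exists (2048 * mertens_bound)^-1, C2; rewrite invr_gt0; split=> //; split=> //.
move=> c f F c1 addf fp limF eps e0 e1.
have bnd := up c f F c1 addf fp limF eps e0 e1.
split; last first.
  apply: ge_sup; first by exists (F (0 + eps) - F 0); exists 0.
  by move=> _ [u _ <-]; exact: bnd.
have [Y Y1 [epsY ->]] := powR_scale c1 e0 e1.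
have Y0 : 0 < Y by lra.
have ndF := cumulative_is_nondecreasing F.
have rcF := cumulative_is_right_continuous F.
(* The window must contain [0, eps/4], where Markov's inequality places the rough numbers, and be
   shorter than eps. *)
have [u1 /andP[u1a u1b] cu1] : exists2 v, - (eps / 4) < v < 0 & {for v, continuous F}.
  by apply: nondecreasing_continuity_point => //; lra.
have [u2 /andP[u2a u2b] cu2] : exists2 v, eps / 4 < v < eps / 2 & {for v, continuous F}.
  by apply: nondecreasing_continuity_point => //; lra.
apply: (@le_trans _ _ (F (u1 + eps) - F u1)); last first.
  (* The upper bound already obtained shows that the supremum is taken over a bounded set. *)
  apply: ub_le_sup; last by exists u1.
  by exists (C2 * min_factor c eps * eps `^ (1 / c)) => _ [u _ <-]; exact: bnd.
apply: (@le_trans _ _ (F u2 - F u1)); last by rewrite lerD2r; apply: ndF; lra.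
rewrite -invfM; apply: (increment_ge limF _ _ _ cu1 cu2).
- by rewrite invr_ge0; apply: mulr_ge0; exact: ltW.
- by lra.
by move=> N; apply: (log_sum_window_ge c1) => //; rewrite -epsY ltW.
Qed.
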